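(* The cyclically conditionally free product is associative: for unital complex algebras $\mathcal{A}_1,\mathcal{A}_2,\mathcal{A}_3$ equipped with triples of linear functionals $(\psi_i,\varphi_i,\omega_i)$ on $\mathcal{A}_i$ ($i=1,2,3$), with $\psi_i,\varphi_i$ unital, $\omega_i$ tracial and $\omega_1(1_{\mathcal{A}_1})=\omega_2(1_{\mathcal{A}_2})=\omega_3(1_{\mathcal{A}_3})$, one has $$\big((\psi_1,\varphi_1,\omega_1)\circledast(\psi_2,\varphi_2,\omega_2)\big)\circledast(\psi_3,\varphi_3,\omega_3)=(\psi_1,\varphi_1,\omega_1)\circledast\big((\psi_2,\varphi_2,\omega_2)\circledast(\psi_3,\varphi_3,\omega_3)\big)$$ on $\mathcal{A}_1\star\mathcal{A}_2\star\mathcal{A}_3$ (under the canonical identification $(\mathcal{A}_1\star\mathcal{A}_2)\star\mathcal{A}_3\cong\mathcal{A}_1\star(\mathcal{A}_2\star\mathcal{A}_3)$).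
   Context: $\star$ is the free product of unital complex algebras with identification of units. A functional $\omega$ is tracial if $\omega(ab)=\omega(ba)$. For subalgebras $(\mathcal{A}_i)$ of an algebra, a sequence $(a_1,\dots,a_n)$ with $a_j\in\mathcal{A}_{i_j}$ is alternating if $i_1\ne i_2\ne\cdots\ne i_n$; cyclically alternating if moreover $i_n\ne i_1$ (so $n\ge2$); centered w.r.t. $\psi$ if $\psi(a_1)=\cdots=\psi(a_n)=0$. Cyclically conditionally free product: for triples $(\psi_i,\varphi_i,\omega_i)$ on unital algebras $\mathcal{A}_i$ ($i=1,2$) with $\psi_i,\varphi_i$ unital, $\omega_i$ tracial and $\omega_1(1)=\omega_2(1)$, $(\psi_1,\varphi_1,\omega_1)\circledast(\psi_2,\varphi_2,\omega_2)=(\psi,\varphi,\omega)$ is the unique triple of linear functionals on $\mathcal{A}_1\star\mathcal{A}_2$ extending the given ones, with $\omega$ tracial, such that: for every alternating sequence centered w.r.t. $\psi$, $\psi(a_1\cdots a_n)=0$ and $\varphi(a_1\cdots a_n)=\varphi(a_1)\cdots\varphi(a_n)$; and for every cyclically alternating sequence centered w.r.t. $\psi$, $\omega(a_1\cdots a_n)=\varphi(a_1)\cdots\varphi(a_n)$. *)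

(* Defs.v *)
From HB Require Import structures.
From mathcomp Require Import all_boot all_order all_algebra.
From mathcomp Require Import generic_quotient.
From mathcomp Require Import all_classical all_reals.
From mathcomp Require Export complex.

Set Implicit Arguments.
Unset Strict Implicit.
Unset Printing Implicit Defensive.

Import GRing.Theory.

Local Open Scope ring_scope.
Local Open Scope quotient_scope.

(* An [algType] is non-trivial (1 != 0).  An algebra carrying a unital linear *)
(* functional is automatically so.  That the free product is non-trivial as   *)
(* well rests on the existence of unital linear functionals on its factors.   *)
Section UnitalFunctional.
Local Open Scope classical_set_scope.
Variables (K : fieldType) (A : algType K).

Lemma exists_unital_functional : exists f : A -> K, scalar f /\ f 1 = 1.
Proof.
pose lin (W : set A) := forall c x y, W x -> W y -> W (c *: x + y).
pose P (W : set A) := lin W /\ ~ W 1.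
have [|W [[linW W1] maxW]] := @Zorn_bigcup A P.
  move=> F FP Ftot; split; last by case=> X /FP [_ X1] /X1.
  move=> c x y [X FX Xx] [Y FY Yy].
  have [XY|YX] := Ftot X Y FX FY.
  - by exists Y => //; apply: (FP _ FY).1 => //; exact: XY.
  - by exists X => //; apply: (FP _ FX).1 => //; exact: YX.
have W0 : W 0.
  apply: contrapT => nW0.
  have Wx x : ~ W x.
    by move=> Wx; apply: nW0; rewrite -(addNr x) -scaleN1r; exact: linW.
  apply: (maxW [set 0]); first by split=> [x /Wx//|/(_ 0 erefl)].
  split=> [c x y /= -> ->|/= /eqP]; first by rewrite scaler0 addr0.
  by rewrite oner_eq0.
have WZ c x : W x -> W (c *: x) by move=> Wx; rewrite -[X in W X]addr0; apply: linW.
have exc x : exists c, W (x - c%:A).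
  apply: contrapT => nex.
  pose B := [set z | exists w d, W w /\ z = w + d *: x].
  apply: (maxW B).
    split=> [w Ww|BW]; first by exists w, 0; rewrite scale0r addr0.
    apply: nex; exists 0; rewrite scale0r subr0; apply: BW.
    by exists 0, 1; rewrite add0r scale1r.
  split=> [c y z [w [d [Ww ->]]] [w' [d' [Ww' ->]]]|[w [d [Ww e]]]].
    exists (c *: w + w'), (c * d + d'); split; first exact: linW.
    by rewrite scalerDr scalerDl scalerA addrACA.
  have d0 : d != 0.
    by apply/eqP => d0; apply: W1; rewrite e d0 scale0r addr0.
  apply: nex; exists d^-1.
  have -> : x - d^-1%:A = (- d^-1) *: w.
    rewrite [in LHS]e scalerDr scalerA mulVf // scale1r scaleNr.
    by rewrite opprD addrCA subrr addr0.
  exact: WZ.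
have unic x c c' : W (x - c%:A) -> W (x - c'%:A) -> c = c'.
  move=> Wc Wc'; apply/eqP; rewrite -subr_eq0; apply: contrapT => /negP ne.
  apply: W1; have : W ((- 1) *: (x - c%:A) + (x - c'%:A)) by exact: linW.
  rewrite scaleN1r opprB addrA subrK -scalerBl => /(WZ (c - c')^-1).
  by rewrite scalerA mulVf // scale1r.
have [f Wf] := choice exc.
exists f; split.
  move=> c x y; apply: (unic (c *: x + y)) => //.
  have -> : c *: x + y - (c * f x + f y)%:A
          = c *: (x - (f x)%:A) + (y - (f y)%:A).
    by rewrite scalerBr scalerA scalerDl opprD addrACA.
  exact: linW.
by apply: (unic 1) => //; rewrite scale1r subrr.
Qed.

End UnitalFunctional.

(* The free product of unital algebras with identification of units,          *)
(* presented by generators and relations: formal algebraic expressions in the *)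
(* elements of A1 and A2, modulo the least congruence satisfying the axioms   *)
(* of unital associative K-algebras and making both inclusions unital         *)
(* K-algebra morphisms.                                                       *)
Section FreeProduct.
Variables (K : fieldType) (A1 A2 : algType K).

Inductive fpterm : Type :=
  | FPl of A1
  | FPr of A2
  | FPzero
  | FPone
  | FPadd of fpterm & fpterm
  | FPmul of fpterm & fpterm
  | FPscale of K & fpterm.

Inductive fpeq : fpterm -> fpterm -> Prop :=
  | fpeq_refl s : fpeq s s
  | fpeq_sym s t : fpeq s t -> fpeq t s
  | fpeq_trans s t u : fpeq s t -> fpeq t u -> fpeq s u
  | fpeq_add s s' t t' : fpeq s s' -> fpeq t t' -> fpeq (FPadd s t) (FPadd s' t')
  | fpeq_mul s s' t t' : fpeq s s' -> fpeq t t' -> fpeq (FPmul s t) (FPmul s' t')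
  | fpeq_scale c s s' : fpeq s s' -> fpeq (FPscale c s) (FPscale c s')
  | fpeq_addA s t u : fpeq (FPadd s (FPadd t u)) (FPadd (FPadd s t) u)
  | fpeq_addC s t : fpeq (FPadd s t) (FPadd t s)
  | fpeq_add0 s : fpeq (FPadd FPzero s) s
  | fpeq_addN s : fpeq (FPadd (FPscale (-1) s) s) FPzero
  | fpeq_mulA s t u : fpeq (FPmul s (FPmul t u)) (FPmul (FPmul s t) u)
  | fpeq_mul1l s : fpeq (FPmul FPone s) s
  | fpeq_mul1r s : fpeq (FPmul s FPone) s
  | fpeq_mulDl s t u : fpeq (FPmul (FPadd s t) u) (FPadd (FPmul s u) (FPmul t u))
  | fpeq_mulDr s t u : fpeq (FPmul s (FPadd t u)) (FPadd (FPmul s t) (FPmul s u))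
  | fpeq_scaleA c d s : fpeq (FPscale c (FPscale d s)) (FPscale (c * d) s)
  | fpeq_scale1 s : fpeq (FPscale 1 s) s
  | fpeq_scaleDr c s t :
      fpeq (FPscale c (FPadd s t)) (FPadd (FPscale c s) (FPscale c t))
  | fpeq_scaleDl c d s :
      fpeq (FPscale (c + d) s) (FPadd (FPscale c s) (FPscale d s))
  | fpeq_scaleAl c s t : fpeq (FPscale c (FPmul s t)) (FPmul (FPscale c s) t)
  | fpeq_scaleAr c s t : fpeq (FPscale c (FPmul s t)) (FPmul s (FPscale c t))
  | fpeq_linl c a b : fpeq (FPl (c *: a + b)) (FPadd (FPscale c (FPl a)) (FPl b))
  | fpeq_mull a b : fpeq (FPl (a * b)) (FPmul (FPl a) (FPl b))
  | fpeq_onel : fpeq (FPl 1) FPone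
  | fpeq_linr c a b : fpeq (FPr (c *: a + b)) (FPadd (FPscale c (FPr a)) (FPr b))
  | fpeq_mulr a b : fpeq (FPr (a * b)) (FPmul (FPr a) (FPr b))
  | fpeq_oner : fpeq (FPr 1) FPone.

Definition fpeqb : rel {classic fpterm} := fun s t => `[< fpeq s t >].

Lemma fpeqb_refl : reflexive fpeqb.
Proof. by move=> s; apply/asboolP; exact: fpeq_refl. Qed.

Lemma fpeqb_sym : symmetric fpeqb.
Proof. by move=> s t; apply/asboolP/asboolP; exact: fpeq_sym. Qed.

Lemma fpeqb_trans : transitive fpeqb.
Proof.
by move=> t s u /asboolP st /asboolP tu; apply/asboolP; exact: fpeq_trans tu.
Qed.

Canonical fpeqb_equiv := EquivRel fpeqb fpeqb_refl fpeqb_sym fpeqb_trans.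

Definition freeprod : Type := {eq_quot fpeqb}.
HB.instance Definition _ := Choice.on freeprod.

Definition fpclass (s : fpterm) : freeprod := \pi_{eq_quot fpeqb} s.
Definition fprepr (x : freeprod) : fpterm := repr x.

Lemma fpreprK x : fpclass (fprepr x) = x.
Proof. exact: reprK. Qed.

Lemma fpclassP s t : fpclass s = fpclass t <-> fpeq s t.
Proof.
split=> [/eqP|st]; last by apply/eqP; rewrite eqmodE; apply/asboolP.
by rewrite eqmodE => /asboolP.
Qed.

Lemma fprepr_class s : fpeq (fprepr (fpclass s)) s.
Proof. by apply/fpclassP; rewrite fpreprK. Qed.

Lemma fpclass_ind (P : freeprod -> Prop) : (forall s, P (fpclass s)) -> forall x, P x.
Proof. by move=> Ps x; rewrite -(fpreprK x). Qed.

Definition fpzero : freeprod := fpclass FPzero.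
Definition fpone : freeprod := fpclass FPone.
Definition fpadd (x y : freeprod) := fpclass (FPadd (fprepr x) (fprepr y)).
Definition fpmul (x y : freeprod) := fpclass (FPmul (fprepr x) (fprepr y)).
Definition fpscale c (x : freeprod) := fpclass (FPscale c (fprepr x)).

Lemma fpaddE s t : fpadd (fpclass s) (fpclass t) = fpclass (FPadd s t).
Proof. by apply/fpclassP/fpeq_add; exact: fprepr_class. Qed.
Lemma fpmulE s t : fpmul (fpclass s) (fpclass t) = fpclass (FPmul s t).
Proof. by apply/fpclassP/fpeq_mul; exact: fprepr_class. Qed.
Lemma fpscaleE c s : fpscale c (fpclass s) = fpclass (FPscale c s).
Proof. by apply/fpclassP/fpeq_scale; exact: fprepr_class. Qed.
Let fpE := (fpaddE, fpmulE, fpscaleE).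

Local Ltac fpax ax :=
  repeat (elim/fpclass_ind => ?); rewrite ?/fpzero ?/fpone ?fpE;
  apply/fpclassP; exact: ax.

Lemma fpaddA : associative fpadd. Proof. fpax fpeq_addA. Qed.
Lemma fpaddC : commutative fpadd. Proof. fpax fpeq_addC. Qed.
Lemma fpadd0 : left_id fpzero fpadd. Proof. fpax fpeq_add0. Qed.
Lemma fpaddN : left_inverse fpzero (fpscale (-1)) fpadd. Proof. fpax fpeq_addN. Qed.

HB.instance Definition _ := GRing.isZmodule.Build freeprod
  fpaddA fpaddC fpadd0 fpaddN.

Lemma fpmulA : associative fpmul. Proof. fpax fpeq_mulA. Qed.
Lemma fpmul1l : left_id fpone fpmul. Proof. fpax fpeq_mul1l. Qed.
Lemma fpmul1r : right_id fpone fpmul. Proof. fpax fpeq_mul1r. Qed.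
Lemma fpmulDl : left_distributive fpmul fpadd. Proof. fpax fpeq_mulDl. Qed.
Lemma fpmulDr : right_distributive fpmul fpadd. Proof. fpax fpeq_mulDr. Qed.

Lemma fpone_neq0 : fpone != fpzero.
Proof.
pose V := A1 -> A2 -> K.
pose bilin (f : V) := (forall y, scalar (f^~ y)) /\ (forall x, scalar (f x)).
pose I := fix I (s : fpterm) (f : V) : V := match s with
  | FPl a => fun x y => f (x * a) y
  | FPr b => fun x y => f x (y * b)
  | FPzero => fun _ _ => 0
  | FPone => f
  | FPadd s t => fun x y => I s f x y + I t f x y
  | FPmul s t => I s (I t f)
  | FPscale c s => fun x y => c * I s f x y
  end.
have Ib s f : bilin f -> bilin (I s f).
  elim: s f => [a|b|||s IHs t IHt|s IHs t IHt|c s IHs] f bf //=.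
  - split=> [y|x]; last exact: bf.2.
    by move=> c x x'; rewrite mulrDl -scalerAl bf.1.
  - split=> [y|x]; first exact: bf.1.
    by move=> c y y'; rewrite mulrDl -scalerAl bf.2.
  - by split=> ? ? ? ?; rewrite mulr0 addr0.
  - have [[s1 s2] [t1 t2]] := (IHs f bf, IHt f bf).
    by split=> [y c x x'|x c y y']; rewrite (s1, s2) (t1, t2) mulrDr addrACA.
  - exact/IHs/IHt.
  - have [s1 s2] := IHs f bf.
    by split=> [y d x x'|x d y y']; rewrite (s1, s2) mulrDr mulrCA.
have ID s f g : I s (fun x y => f x y + g x y) = fun x y => I s f x y + I s g x y.
  elim: s f g => [a|b|||s IHs t IHt|s IHs t IHt|c s IHs] f g //=;
    apply/funext => x; apply/funext => y //=.
  - by rewrite addr0.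
  - by rewrite IHs IHt addrACA.
  - by rewrite IHt IHs.
  - by rewrite IHs mulrDr.
have IZ s c f : I s (fun x y => c * f x y) = fun x y => c * I s f x y.
  elim: s f => [a|b|||s IHs t IHt|s IHs t IHt|d s IHs] f //=;
    apply/funext => x; apply/funext => y //=.
  - by rewrite mulr0.
  - by rewrite IHs IHt mulrDr.
  - by rewrite IHt IHs.
  - by rewrite IHs mulrCA.
have IP s t : fpeq s t -> forall f, bilin f -> I s f = I t f.
  elim=> {s t} //=.
  - by move=> s t _ IH f bf; rewrite IH.
  - by move=> s t u _ IH1 _ IH2 f bf; rewrite IH1 // IH2.
  - by move=> s s' t t' _ IH1 _ IH2 f bf; rewrite IH1 // IH2.
  - by move=> s s' t t' _ IH1 _ IH2 f bf; rewrite IH2 // IH1 //; exact: Ib.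
  - by move=> c s s' _ IH f bf; rewrite IH.
  - by move=> s t u f _; apply/funext => x; apply/funext => y; rewrite addrA.
  - by move=> s t f _; apply/funext => x; apply/funext => y; rewrite addrC.
  - by move=> s f _; apply/funext => x; apply/funext => y; rewrite add0r.
  - by move=> s f _; apply/funext => x; apply/funext => y; rewrite mulN1r addNr.
  - by move=> s c d f _; apply/funext => x; apply/funext => y; rewrite mulrA.
  - by move=> s f _; apply/funext => x; apply/funext => y; rewrite mul1r.
  - by move=> c s t f _; apply/funext => x; apply/funext => y; rewrite mulrDr.
  - by move=> c d s f _; apply/funext => x; apply/funext => y; rewrite mulrDl.
  - by move=> c a b f bf; apply/funext => x; apply/funext => y;
      rewrite mulrDr -scalerAr bf.1.
  - by move=> a b f _; apply/funext => x; apply/funext => y; rewrite mulrA.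
  - by move=> f _; apply/funext => x; apply/funext => y; rewrite mulr1.
  - by move=> c a b f bf; apply/funext => x; apply/funext => y;
      rewrite mulrDr -scalerAr bf.2.
  - by move=> a b f _; apply/funext => x; apply/funext => y; rewrite mulrA.
  - by move=> f _; apply/funext => x; apply/funext => y; rewrite mulr1.
have [f1 [l1 f11]] := exists_unital_functional A1.
have [f2 [l2 f21]] := exists_unital_functional A2.
pose f : V := fun x y => f1 x * f2 y.
have bf : bilin f.
  split=> [y c x x'|x c y y']; first by rewrite /f l1 mulrDl mulrA.
  by rewrite /f l2 mulrDr mulrCA.
apply/eqP => /fpclassP /IP /(_ f bf) /= /(congr1 (fun g => g 1 1)).
by rewrite /f f11 f21 mulr1 => /eqP; rewrite oner_eq0.
Qed.

HB.instance Definition _ := GRing.Zmodule_isNzRing.Build freeprod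
  fpmulA fpmul1l fpmul1r fpmulDl fpmulDr fpone_neq0.

Lemma fpscaleA c d x : fpscale c (fpscale d x) = fpscale (c * d) x.
Proof. by move: x; fpax fpeq_scaleA. Qed.
Lemma fpscale1 : left_id 1 fpscale. Proof. fpax fpeq_scale1. Qed.
Lemma fpscaleDr : right_distributive fpscale fpadd.
Proof. by move=> c; fpax fpeq_scaleDr. Qed.
Lemma fpscaleDl x : {morph fpscale^~ x : c d / c + d >-> fpadd c d}.
Proof. by move: x; elim/fpclass_ind => s c d; fpax fpeq_scaleDl. Qed.
Lemma fpscaleAl c x y : fpscale c (fpmul x y) = fpmul (fpscale c x) y.
Proof. by move: x y; fpax fpeq_scaleAl. Qed.
Lemma fpscaleAr c x y : fpscale c (fpmul x y) = fpmul x (fpscale c y).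
Proof. by move: x y; fpax fpeq_scaleAr. Qed.

HB.instance Definition _ := GRing.Zmodule_isLmodule.Build K freeprod
  fpscaleA fpscale1 fpscaleDr fpscaleDl.
HB.instance Definition _ := GRing.Lmodule_isLalgebra.Build K freeprod fpscaleAl.
HB.instance Definition _ := GRing.Lalgebra_isAlgebra.Build K freeprod fpscaleAr.

Definition fpinl (a : A1) : freeprod := fpclass (FPl a).
Definition fpinr (b : A2) : freeprod := fpclass (FPr b).

Lemma fpinl_linear : linear fpinl.
Proof.
move=> c a b; rewrite [LHS](_ : _ = fpclass (FPadd (FPscale c (FPl a)) (FPl b)));
  last exact/fpclassP/fpeq_linl.
by rewrite -fpaddE -fpscaleE.
Qed.

Lemma fpinl_monoid : monoid_morphism fpinl.
Proof.
split=> [|a b]; first exact/fpclassP/fpeq_onel.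
by rewrite [RHS]fpmulE; exact/fpclassP/fpeq_mull.
Qed.

Lemma fpinr_linear : linear fpinr.
Proof.
move=> c a b; rewrite [LHS](_ : _ = fpclass (FPadd (FPscale c (FPr a)) (FPr b)));
  last exact/fpclassP/fpeq_linr.
by rewrite -fpaddE -fpscaleE.
Qed.

Lemma fpinr_monoid : monoid_morphism fpinr.
Proof.
split=> [|a b]; first exact/fpclassP/fpeq_oner.
by rewrite [RHS]fpmulE; exact/fpclassP/fpeq_mulr.
Qed.

HB.instance Definition _ :=
  GRing.isLinear.Build K A1 freeprod *:%R fpinl fpinl_linear.
HB.instance Definition _ :=
  GRing.isMonoidMorphism.Build A1 freeprod fpinl fpinl_monoid.
HB.instance Definition _ :=
  GRing.isLinear.Build K A2 freeprod *:%R fpinr fpinr_linear.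
HB.instance Definition _ :=
  GRing.isMonoidMorphism.Build A2 freeprod fpinr fpinr_monoid.

End FreeProduct.

Arguments fpinl {K A1 A2} a.
Arguments fpinr {K A1 A2} b.

Section UniversalProperty.
Variables (K : fieldType) (A1 A2 B : algType K).

Lemma freeprod_hom_ext (h k : {lrmorphism freeprod A1 A2 -> B}) :
  (forall a, h (fpinl a) = k (fpinl a)) ->
  (forall b, h (fpinr b) = k (fpinr b)) -> h =1 k.
Proof.
move=> hkl hkr; elim/fpclass_ind.
elim=> [a|b|||s IHs t IHt|s IHs t IHt|c s IHs].
- exact: hkl.
- exact: hkr.
- by rewrite -[fpclass _]/(0 : freeprod A1 A2) !rmorph0.
- by rewrite -[fpclass _]/(1 : freeprod A1 A2) !rmorph1.
- rewrite -fpaddE -[fpadd _ _]/(fpclass s + fpclass t).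
  by rewrite !rmorphD /= IHs IHt.
- rewrite -fpmulE -[fpmul _ _]/(fpclass s * fpclass t).
  by rewrite !rmorphM /= IHs IHt.
- rewrite -fpscaleE -[fpscale _ _]/(c *: fpclass s).
  by rewrite !linearZ /= IHs.
Qed.

Variables (f : {lrmorphism A1 -> B}) (g : {lrmorphism A2 -> B}).

Fixpoint fpeval (s : fpterm A1 A2) : B := match s with
  | FPl a => f a
  | FPr b => g b
  | FPzero => 0
  | FPone => 1
  | FPadd s t => fpeval s + fpeval t
  | FPmul s t => fpeval s * fpeval t
  | FPscale c s => c *: fpeval s
  end.

Lemma fpeval_eq s t : fpeq s t -> fpeval s = fpeval t.
Proof.
elim=> {s t} //=.
- by move=> s t u _ -> _ ->.
- by move=> s s' t t' _ -> _ ->.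
- by move=> s s' t t' _ -> _ ->.
- by move=> c s s' _ ->.
- by move=> s t u; rewrite addrA.
- by move=> s t; rewrite addrC.
- by move=> s; rewrite add0r.
- by move=> s; rewrite scaleN1r addNr.
- by move=> s t u; rewrite mulrA.
- by move=> s; rewrite mul1r.
- by move=> s; rewrite mulr1.
- by move=> s t u; rewrite mulrDl.
- by move=> s t u; rewrite mulrDr.
- by move=> c d s; rewrite scalerA.
- by move=> s; rewrite scale1r.
- by move=> c s t; rewrite scalerDr.
- by move=> c d s; rewrite scalerDl.
- by move=> c s t; rewrite scalerAl.
- by move=> c s t; rewrite scalerAr.
- by move=> c a b; rewrite linearP.
- by move=> a b; rewrite rmorphM.
- by rewrite rmorph1.
- by move=> c a b; rewrite linearP.
- by move=> a b; rewrite rmorphM.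
- by rewrite rmorph1.
Qed.

Definition freeprod_lift (x : freeprod A1 A2) : B := fpeval (fprepr x).

Lemma freeprod_lift_class s : freeprod_lift (fpclass s) = fpeval s.
Proof. exact/fpeval_eq/fprepr_class. Qed.

Lemma freeprod_lift_linear : linear freeprod_lift.
Proof.
move=> c; elim/fpclass_ind=> s; elim/fpclass_ind=> t.
rewrite -[_ + _]/(fpadd (fpscale _ _) _) fpscaleE fpaddE.
by rewrite !freeprod_lift_class.
Qed.

Lemma freeprod_lift_monoid : monoid_morphism freeprod_lift.
Proof.
split=> [|]; first exact: freeprod_lift_class.
elim/fpclass_ind=> s; elim/fpclass_ind=> t.
by rewrite -[_ * _]/(fpmul _ _) fpmulE !freeprod_lift_class.
Qed.

HB.instance Definition _ :=
  GRing.isLinear.Build K (freeprod A1 A2) B *:%R freeprod_lift freeprod_lift_linear.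
HB.instance Definition _ :=
  GRing.isMonoidMorphism.Build (freeprod A1 A2) B freeprod_lift freeprod_lift_monoid.

Lemma freeprod_lift_inl a : freeprod_lift (fpinl a) = f a.
Proof. exact: freeprod_lift_class. Qed.
Lemma freeprod_lift_inr b : freeprod_lift (fpinr b) = g b.
Proof. exact: freeprod_lift_class. Qed.

End UniversalProperty.

Section Associator.
Variables (K : fieldType) (A1 A2 A3 : algType K).

Let A12 : algType K := freeprod A1 A2.
Let A23 : algType K := freeprod A2 A3.

Definition fp_assoc : {lrmorphism freeprod A12 A3 -> freeprod A1 A23} :=
  freeprod_lift
    (freeprod_lift (fpinl : A1 -> freeprod A1 A23)
                   ((fpinr : A23 -> freeprod A1 A23) \o (fpinl : A2 -> A23)))
    ((fpinr : A23 -> freeprod A1 A23) \o (fpinr : A3 -> A23)).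

Definition fp_unassoc : {lrmorphism freeprod A1 A23 -> freeprod A12 A3} :=
  freeprod_lift
    ((fpinl : A12 -> freeprod A12 A3) \o (fpinl : A1 -> A12))
    (freeprod_lift ((fpinl : A12 -> freeprod A12 A3) \o (fpinr : A2 -> A12))
                   (fpinr : A3 -> freeprod A12 A3)).

Lemma fp_assocK : cancel fp_assoc fp_unassoc.
Proof.
move=> x; suff /(_ x) : fp_unassoc \o fp_assoc =1 idfun by [].
apply: (freeprod_hom_ext (h := fp_unassoc \o fp_assoc) (k := idfun)).
- apply: (freeprod_hom_ext (h := fp_unassoc \o fp_assoc \o fpinl) (k := fpinl)).
  + by move=> a; do 3?[rewrite /= freeprod_lift_inl].
  + move=> b; rewrite /= freeprod_lift_inl /= freeprod_lift_inr /=.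
    by rewrite freeprod_lift_inr /= freeprod_lift_inl.
- by move=> c; do 3?[rewrite /= freeprod_lift_inr].
Qed.

Lemma fp_unassocK : cancel fp_unassoc fp_assoc.
Proof.
move=> x; suff /(_ x) : fp_assoc \o fp_unassoc =1 idfun by [].
apply: (freeprod_hom_ext (h := fp_assoc \o fp_unassoc) (k := idfun)).
- by move=> a; do 3?[rewrite /= freeprod_lift_inl].
- apply: (freeprod_hom_ext (h := fp_assoc \o fp_unassoc \o fpinr) (k := fpinr)).
  + move=> b; rewrite /= freeprod_lift_inr /= freeprod_lift_inl /=.
    by rewrite freeprod_lift_inl /= freeprod_lift_inr.
  + by move=> c; do 3?[rewrite /= freeprod_lift_inr].
Qed.

End Associator.

Record triple (K : fieldType) (A : algType K) := Triple {
  tpsi : {scalar A};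
  tphi : {scalar A};
  tomega : {scalar A}
}.

Definition tracial (K : fieldType) (A : algType K) (f : {scalar A}) : Prop :=
  forall a b, f (a * b) = f (b * a).

Definition admissible (K : fieldType) (A : algType K) (t : triple A) : Prop :=
  [/\ tpsi t 1 = 1, tphi t 1 = 1 & tracial (tomega t)].

Definition triple_comp (K : fieldType) (A B : algType K) (t : triple B)
    (h : {lrmorphism A -> B}) : triple A :=
  Triple (tpsi t \o h) (tphi t \o h) (tomega t \o h).

Section CyclicallyConditionallyFreeProduct.
Variables (K : fieldType) (A1 A2 : algType K).

(* A sequence (a_1, ..., a_n) with each a_j in A1 or A2 is a sequence of      *)
(* tagged elements, the tag recording the index i_j.                          *)
Definition fpletter (x : A1 + A2) : freeprod A1 A2 :=
  match x with inl a => fpinl a | inr b => fpinr b end.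

Definition other_side (x y : A1 + A2) : bool :=
  match x, y with inl _, inr _ | inr _, inl _ => true | _, _ => false end.

Definition alternating (s : seq (A1 + A2)) : bool :=
  (0 < size s)%N && sorted other_side s.

(* [cycle] also compares the last element with the first, so that it rejects  *)
(* singletons.                                                                *)
Definition cyc_alternating (s : seq (A1 + A2)) : bool :=
  (0 < size s)%N && cycle other_side s.

Definition centered (psi : {scalar freeprod A1 A2}) (s : seq (A1 + A2)) : bool :=
  all (fun x => psi (fpletter x) == 0) s.

Definition extends (f1 : {scalar A1}) (f2 : {scalar A2})
    (f : {scalar freeprod A1 A2}) : Prop :=
  (forall a, f (fpinl a) = f1 a) /\ (forall b, f (fpinr b) = f2 b).

Record is_ccfprod (t1 : triple A1) (t2 : triple A2)
    (t : triple (freeprod A1 A2)) : Prop := IsCcfprod {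
  ccf_psi_ext : extends (tpsi t1) (tpsi t2) (tpsi t);
  ccf_phi_ext : extends (tphi t1) (tphi t2) (tphi t);
  ccf_omega_ext : extends (tomega t1) (tomega t2) (tomega t);
  ccf_omega_tracial : tracial (tomega t);
  ccf_psi : forall s, alternating s -> centered (tpsi t) s ->
    tpsi t (\prod_(x <- s) fpletter x) = 0;
  ccf_phi : forall s, alternating s -> centered (tpsi t) s ->
    tphi t (\prod_(x <- s) fpletter x) = \prod_(x <- s) tphi t (fpletter x);
  ccf_omega : forall s, cyc_alternating s -> centered (tpsi t) s ->
    tomega t (\prod_(x <- s) fpletter x) = \prod_(x <- s) tphi t (fpletter x)
}.

(* The triple characterized by [is_ccfprod]; the default can only matter     *)
(* outside the domain of the operation, i.e. when t1 and t2 are not           *)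
(* admissible or their third components disagree at 1.                        *)
Definition ccfprod (t1 : triple A1) (t2 : triple A2) : triple (freeprod A1 A2) :=
  let default := Triple \0 \0 \0 : triple (freeprod A1 A2) in
  xget (default : {classic triple (freeprod A1 A2)}) (is_ccfprod t1 t2).

End CyclicallyConditionallyFreeProduct.

(* Main.v *)
Require Import Defs.
From mathcomp Require Import all_boot all_order all_algebra.
From mathcomp Require Import all_classical all_reals complex.
From mathcomp Require Import ring.
From HB Require Import structures.

Set Implicit Arguments.
Unset Strict Implicit.
Unset Printing Implicit Defensive.

Import GRing.Theory.

Local Open Scope ring_scope.

(** Both bracketings live, up to the associator, on the algebra generated by
    A1, A2 and A3, and both satisfy the same threefold rule: on a word whose
    letters are taken from A1, A2, A3, are centered for psi, and come from
    different algebras whenever they are adjacent, psi vanishes and phi is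
    multiplicative; omega is the product of the phi values when, in addition,
    the first and last letters come from different algebras.  That rule,
    traciality and the values on single letters determine the three
    functionals, so the two bracketings agree.

    The rule holds for a bracketing because of the grouping argument
    [cc_free_group].  Cut a threefold word into maximal runs lying in the same
    factor of the outer product, say A1 * A2 and A3.  By the rule for the inner
    product, the product of a run is again centered, and phi is multiplicative
    on it; hence the sequence of these products is a legal word for the outer
    product.  For omega one first rotates the word, using the trace, so that a
    run does not wrap around its end; if the whole word is one run, the inner
    product already gives the answer.

    Uniqueness ([cc_free_unique]) is the usual reduction: merging neighbours
    from the same algebra and subtracting psi from the letters writes any
    product as a combination of reduced words; for omega, a reduced word whose
    two ends lie in the same algebra is shortened by cyclically merging them.

    As the product is obtained by choosing a triple satisfying its defining
    conditions, its existence is needed as well ([ccfprod_exists]).  A function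
    f on words, linear in each letter, extends from reduced words to a linear
    functional on the free product ([word_functional]): letters act on such
    functions, dually to left multiplication on normal forms, and the action
    respects the relations defining the free product.  Applying this to the
    indicator of the empty word gives psi, and the product of the phi values
    gives phi.  For omega one takes the function [omega_word] that peels off the
    two ends of a word, as traciality dictates; that the result is a trace is
    then checked on commutators with one centered letter, by comparing the side
    of that letter with those of the two ends ([omega_letter_comm]). *)

(** * Words over an alphabet of elements of an algebra *)

Section ScalarForms.
Variables (K : fieldType) (B : algType K).

Lemma scalarZ (f : {scalar B}) c x : f (c *: x) = c * f x.
Proof. by rewrite linearZ. Qed.

Lemma scalarB (f : {scalar B}) x y : f (x - y) = f x - f y.
Proof. by rewrite raddfB. Qed.

Lemma scalar_sub (f g : {scalar B}) : scalar (fun x => f x - g x).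
Proof. by move=> c x y; rewrite !linearP mulrBr opprD addrACA. Qed.

End ScalarForms.

(** Working with an abstract alphabet, in which a letter has a tag (the factor
    it belongs to) and a value in B, puts words over two factors and words over
    three factors, in any of their realizations, under the same lemmas. *)
Section Words.
Variables (K : fieldType) (B : algType K) (I : eqType) (L : Type).
Variables (tag : L -> I) (val : L -> B).

Definition wprod (w : seq L) : B := \prod_(x <- w) val x.

Lemma wprod0 : wprod [::] = 1. Proof. exact: big_nil. Qed.
Lemma wprod_cons x w : wprod (x :: w) = val x * wprod w.
Proof. exact: big_cons. Qed.
Lemma wprod_cat u v : wprod (u ++ v) = wprod u * wprod v.
Proof. exact: big_cat. Qed.

Definition neqr : rel I := fun i j => i != j.

Definition reduced (psi : B -> K) (w : seq L) : bool :=
  sorted neqr (map tag w) && all (fun x => psi (val x) == 0) w.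

Definition cyc_reduced (psi : B -> K) (w : seq L) : bool :=
  [&& (0 < size w)%N, cycle neqr (map tag w) &
      all (fun x => psi (val x) == 0) w].

Record cc_free (t : triple B) : Prop := CcFree {
  ccfree_psi : forall w, (0 < size w)%N -> reduced (tpsi t) w ->
    tpsi t (wprod w) = 0;
  ccfree_phi : forall w, (0 < size w)%N -> reduced (tpsi t) w ->
    tphi t (wprod w) = \prod_(x <- w) tphi t (val x);
  ccfree_omega : forall w, cyc_reduced (tpsi t) w ->
    tomega t (wprod w) = \prod_(x <- w) tphi t (val x)
}.

Definition generating : Prop := forall P : B -> Prop,
  (forall x, P (val x)) ->
  (forall c a b, P a -> P b -> P (c *: a + b)) ->
  (forall a b, P a -> P b -> P (a * b)) -> forall b, P b.

(** Functionals vanishing on all words are stable under precomposition with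
    left multiplication by any x: this is what makes the induction on the
    generation of x go through products. *)
Lemma vanish_of_words (d : B -> K) : generating -> scalar d ->
  (forall w, d (wprod w) = 0) -> forall x, d x = 0.
Proof.
move=> gen.
suff H : forall x d, scalar d -> (forall w, d (wprod w) = 0) ->
    forall w, d (x * wprod w) = 0.
  by move=> ld dw x; rewrite -[x]mulr1 -wprod0; exact: H.
apply: gen => [x {}d ld dw w|c a b Pa Pb {}d ld dw w|a b Pa Pb {}d ld dw w].
- by rewrite -wprod_cons.
- by rewrite mulrDl -scalerAl ld Pa // Pb // mulr0 addr0.
- rewrite -mulrA; apply: (Pb (fun y => d (a * y))) => [e y z|v]; last exact: Pa.
  by rewrite mulrDr -scalerAr ld.
Qed.

Record multiplicative_alphabet : Prop := MultiplicativeAlphabet {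
  letter_merge : forall x y, tag x = tag y ->
    exists2 z, tag z = tag x & val z = val x * val y;
  letter_shift : forall x c, exists2 z, tag z = tag x & val z = val x - c%:A
}.

Lemma not_sorted_split (w : seq L) : ~~ sorted neqr (map tag w) ->
  exists u x y v, w = u ++ x :: y :: v /\ tag x = tag y.
Proof.
elim: w => [|x [|y w] IH] //=; rewrite negb_and negbK.
case/orP => [/eqP xy|/IH [u [x' [y' [v [-> e]]]]]].
  by exists [::], x, y, w.
by exists (x :: u), x', y', v.
Qed.

(** Equal neighbours merge into a shorter word.  In a word without equal
    neighbours, the letters are centered from left to right; replacing x by
    x - psi x changes the product by a multiple of a shorter word.  The
    hypothesis on reduced words grants the vanishing on shorter words so that
    a caller may itself shorten reduced words, as the trace does. *)
Lemma vanish_of_reduced (psi : {scalar B}) (d : B -> K) :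
  multiplicative_alphabet -> psi 1 = 1 -> scalar d ->
  (forall w, reduced psi w ->
     (forall v, (size v < size w)%N -> d (wprod v) = 0) -> d (wprod w) = 0) ->
  forall w, d (wprod w) = 0.
Proof.
move=> [merge shift] psi1 ld dred w.
have [n] := ubnP (size w); elim: n w => // n IHn w; rewrite ltnS => wn.
have {wn}IH v : (size v < size w)%N -> d (wprod v) = 0.
  by move=> vw; apply: IHn; exact: leq_trans wn.
have [srt|/not_sorted_split [u [x [y [v [ew /merge [z _ ez]]]]]]] :=
  boolP (sorted neqr (map tag w)); last first.
  have -> : wprod w = wprod (u ++ z :: v).
    by rewrite ew !wprod_cat !wprod_cons ez -(mulrA (val x)).
  by apply: IH; rewrite ew !size_cat /= !addnS ltnS.
(* u is the part of the word which is already centered *)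
suff H : forall v u, size (u ++ v) = size w -> sorted neqr (map tag (u ++ v)) ->
    all (fun x => psi (val x) == 0) u -> d (wprod (u ++ v)) = 0.
  exact: (H w [::]).
elim=> [|x v IHv] u; first by rewrite cats0 => sz su cu; apply: dred;
  [rewrite /reduced su|move=> v; rewrite sz; exact: IH].
move=> sz suv cu; have [z tz vz] := shift x (psi (val x)).
have psiz : psi (val z) = 0.
  by rewrite vz scalarB scalarZ psi1 mulr1 subrr.
have -> : wprod (u ++ x :: v)
    = psi (val x) *: wprod (u ++ v) + wprod (rcons u z ++ v).
  rewrite cat_rcons !wprod_cat !wprod_cons vz mulrBl mulrBr mulr_algl.
  by rewrite -scalerAr addrC subrK.
rewrite ld IH; last by rewrite -sz !size_cat /= addnS.
rewrite mulr0 add0r; apply: IHv.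
- by rewrite cat_rcons -sz !size_cat.
- by move: suv; rewrite cat_rcons !map_cat /= tz.
- by rewrite all_rcons psiz eqxx.
Qed.

Lemma eq_letters_reduced (f g : B -> K) w :
  (forall x, f (val x) = g (val x)) -> reduced f w = reduced g w.
Proof.
move=> fg; rewrite /reduced (eq_all (a2 := fun x => g (val x) == 0)) //.
by move=> x; rewrite fg.
Qed.

Lemma eq_letters_cyc_reduced (f g : B -> K) w :
  (forall x, f (val x) = g (val x)) -> cyc_reduced f w = cyc_reduced g w.
Proof.
move=> fg; rewrite /cyc_reduced (eq_all (a2 := fun x => g (val x) == 0)) //.
by move=> x; rewrite fg.
Qed.

Lemma cyc_reduced_ends psi x m y : tag x != tag y ->
  reduced psi (x :: rcons m y) -> cyc_reduced psi (x :: rcons m y).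
Proof.
move=> xy /andP [srt cen]; rewrite /cyc_reduced cen /= andbT.
rewrite rcons_path; move: srt => /= ->.
by rewrite map_rcons last_rcons /neqr eq_sym.
Qed.

(** Reduced words determine psi and phi at once.  For omega, the reduced words
    left over by the cyclic rule have both ends in one factor; rotating the
    last letter to the front and merging it with the first one gives a shorter
    word. *)
Lemma cc_free_unique (t t' : triple B) :
  multiplicative_alphabet -> generating ->
  (exists x, val x = 1) -> tpsi t 1 = 1 ->
  cc_free t -> cc_free t' -> tracial (tomega t) -> tracial (tomega t') ->
  (forall x, [/\ tpsi t (val x) = tpsi t' (val x),
                 tphi t (val x) = tphi t' (val x) &
                 tomega t (val x) = tomega t' (val x)]) ->
  [/\ tpsi t =1 tpsi t', tphi t =1 tphi t' & tomega t =1 tomega t'].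
Proof.
move=> malph gen [e ve] psi1 [psit phit omt] [psit' phit' omt'] tr tr' ext.
have extpsi x : tpsi t (val x) = tpsi t' (val x) by case: (ext x).
have extphi x : tphi t (val x) = tphi t' (val x) by case: (ext x).
have extom x : tomega t (val x) = tomega t' (val x) by case: (ext x).
have agree (f g : {scalar B}) :
    (forall x, f (val x) = g (val x)) ->
    (forall w, (0 < size w)%N -> reduced (tpsi t) w ->
      (forall v, (size v < size w)%N -> f (wprod v) = g (wprod v)) ->
      f (wprod w) = g (wprod w)) -> f =1 g.
  move=> fg fgr x; apply/eqP; rewrite -subr_eq0; apply/eqP.
  move: x; apply: (vanish_of_words gen (scalar_sub f g)).
  apply: (vanish_of_reduced (d := fun x => f x - g x) malph psi1).
    exact: scalar_sub.
  move=> [|y w] rw IH; first by rewrite wprod0 -ve fg subrr.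
  apply/eqP; rewrite subr_eq0; apply/eqP/fgr => // v vw.
  by apply/eqP; rewrite -subr_eq0 IH.
have prodphi w : \prod_(x <- w) tphi t (val x) = \prod_(x <- w) tphi t' (val x).
  by apply: eq_bigr => x _.
split; apply: agree => // w w0 rw IH.
- by rewrite psit // psit' // -(eq_letters_reduced _ extpsi).
- by rewrite phit // phit' // -(eq_letters_reduced _ extpsi).
case: w w0 rw IH => // x w _; case/lastP: w => [|m y] rw IH.
  by rewrite wprod_cons wprod0 mulr1.
have [xy|xy] := eqVneq (tag x) (tag y); last first.
  have crw := cyc_reduced_ends xy rw.
  by rewrite omt // omt' // -(eq_letters_cyc_reduced _ extpsi).
have [z _ vz] := letter_merge malph (esym xy).
have cycl (f : {scalar B}) : tracial f ->
    f (wprod (x :: rcons m y)) = f (wprod (z :: m)).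
  move=> trf; rewrite -rcons_cons -cats1 wprod_cat trf !wprod_cons wprod0 mulr1.
  by rewrite vz mulrA.
by rewrite !cycl // IH //= size_rcons.
Qed.

End Words.

Arguments neqr {I}.

(** * Grouping the letters of a word into runs *)

(** The letters of L are refined pieces of the letters of M: f says in which
    coarse factor a letter lies, and a reduced word inside one coarse factor
    has a product which is the value of a centered letter of M. *)
Section Grouping.
Variables (K : fieldType) (B : algType K).
Variables (I J : eqType) (L M : Type).
Variables (tag : L -> I) (val : L -> B) (tagM : M -> J) (valM : M -> B).
Variables (f : L -> J) (t : triple B).

Hypothesis run_letter : forall x u, reduced tag val (tpsi t) (x :: u) ->
  all (fun y => f y == f x) u ->
  exists z, [/\ tagM z = f x, valM z = wprod val (x :: u), tpsi t (valM z) = 0 &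
                tphi t (valM z) = \prod_(y <- x :: u) tphi t (val y)].

Hypothesis run_cyc : forall x u, cyc_reduced tag val (tpsi t) (x :: u) ->
  all (fun y => f y == f x) u ->
  tomega t (wprod val (x :: u)) = \prod_(y <- x :: u) tphi t (val y).

(** The induction on p has to keep the first run x :: u open, because the next
    letter to the left may extend it.  The word w of the later runs is required
    to be reduced behind any centered letter carrying the coarse tag of the
    open run. *)
Lemma group_runs x p : reduced tag val (tpsi t) (x :: p) ->
  exists z w, [/\ reduced tagM valM (tpsi t) (z :: w),
    tagM z = f x, tagM (last z w) = f (last x p),
    wprod valM (z :: w) = wprod val (x :: p) &
    \prod_(y <- z :: w) tphi t (valM y) = \prod_(y <- x :: p) tphi t (val y)].
Proof.
suff H : reduced tag val (tpsi t) (x :: p) -> exists u v w,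
    [/\ p = u ++ v, all (fun y => f y == f x) u,
        reduced tag val (tpsi t) (x :: u),
        forall z, tagM z = f x -> tpsi t (valM z) = 0 ->
          reduced tagM valM (tpsi t) (z :: w) /\
          tagM (last z w) = f (last x p) &
        wprod valM w = wprod val v /\
        \prod_(y <- w) tphi t (valM y) = \prod_(y <- v) tphi t (val y)].
  move=> /H [u [v [w [-> fu ru rw [pw phiw]]]]].
  have [z [tz vz pz phiz]] := run_letter ru fu.
  have [rzw lw] := rw z tz pz; exists z, w; split=> //.
    by rewrite wprod_cons pw vz -wprod_cat.
  by rewrite big_cons phiz phiw -big_cat.
elim: p x => [|y p IHp] x rx.
  exists [::], [::], [::]; split=> //; last by rewrite !big_nil /wprod !big_nil.
  by move=> z tz pz; rewrite /reduced /= pz eqxx.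
have /andP [/= /andP [xy srt] /andP [cx cp]] := rx.
have ryp : reduced tag val (tpsi t) (y :: p) by rewrite /reduced /= srt.
have [u [v [w [ep fu ru rw [pw phiw]]]]] := IHp y ryp.
have [fxy|fxy] := eqVneq (f y) (f x).
  exists (y :: u), v, w; split=> //.
  - by rewrite ep.
  - by rewrite /= fxy eqxx /= -fxy.
  - by move: ru; rewrite /reduced /= xy cx.
  - by rewrite -fxy.
have [z [tz vz pz phiz]] := run_letter ru fu.
have [rzw lw] := rw z tz pz.
exists [::], (y :: p), (z :: w); split=> //.
- by rewrite /reduced /= cx.
- move=> z' tz' pz'; split; last by [].
  move: rzw; rewrite /reduced /= => /andP [-> ->].
  by rewrite pz' eqxx tz' tz /neqr eq_sym fxy.
- split; first by rewrite wprod_cons pw vz -wprod_cat cat_cons -ep.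
  by rewrite big_cons phiz phiw -big_cat cat_cons -ep.
Qed.

Lemma cyc_reduced_rot psi u v : cyc_reduced tag val psi (u ++ v) ->
  cyc_reduced tag val psi (v ++ u).
Proof.
case/and3P=> sz cyc cen; apply/and3P; split.
- by move: sz; rewrite !size_cat addnC.
- by rewrite map_cat -rot_size_cat rot_cycle -map_cat.
- by move: cen; rewrite !all_cat andbC.
Qed.

Lemma cyc_reduced_reduced psi w : cyc_reduced tag val psi w ->
  reduced tag val psi w.
Proof.
case: w => // x w /and3P [_ /=]; rewrite rcons_path => /andP [srt _] cen.
by rewrite /reduced /= srt.
Qed.

(** For the cyclic rule, the first and last runs must lie in different coarse
    factors.  If the word is not a single run, it has a point where the coarse
    factor changes, and the trace allows to start there. *)
Lemma cc_free_group : tracial (tomega t) -> cc_free tagM valM t ->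
  cc_free tag val t.
Proof.
move=> tr [psiM phiM omM]; split=> [[//|x p] _|[//|x p] _|].
- by move=> /group_runs [z [w [rw _ _ <- _]]]; exact: psiM.
- by move=> /group_runs [z [w [rw _ _ <- <-]]]; exact: phiM.
suff H : forall x p, cyc_reduced tag val (tpsi t) (x :: p) ->
    f x != f (last x p) ->
    tomega t (wprod val (x :: p)) = \prod_(y <- x :: p) tphi t (val y).
  case=> // x p cyc; have [fp|] := boolP (all (fun y => f y == f x) p).
    exact: run_cyc.
  rewrite -has_predC => hp; case: (split_find hp) cyc => y u v /= fy nfu.
  rewrite cat_rcons -cat_cons wprod_cat tr -wprod_cat => cyc.
  rewrite big_cat /= mulrC -big_cat /=; apply: H.
    exact: (@cyc_reduced_rot _ (x :: u) (y :: v)).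
  rewrite last_cat /=; apply: contra fy => /eqP ->.
  rewrite has_predC negbK in nfu.
  case/lastP: u nfu {cyc} => [|u z] //.
  by rewrite all_rcons last_rcons => /andP [].
move=> x p cyc fxp.
have [z [w [rw tz lz <- <-]]] := group_runs (cyc_reduced_reduced cyc).
rewrite -tz -lz in fxp.
case/lastP: w rw fxp {lz} => [|w y] rw; first by rewrite eqxx.
by rewrite last_rcons => zy; apply: omM; exact: cyc_reduced_ends.
Qed.

End Grouping.

(** * Linear functionals on the free product from functions on words *)

Section Letters.
Variables (K : fieldType) (A1 A2 : algType K).
Local Notation letter := (A1 + A2)%type.
Local Notation fpval := (@fpletter K A1 A2).
Implicit Types x y z l : letter.

Definition side x : bool := if x is inl _ then true else false.

Lemma other_sideE x y : other_side x y = neqr (side x) (side y).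
Proof. by case: x y => ? []. Qed.

Definition letter_form (f1 : A1 -> K) (f2 : A2 -> K) x : K :=
  match x with inl a => f1 a | inr b => f2 b end.

Definition lunit (s : bool) : letter := if s then inl 1 else inr 1.

(** Letters of either factor are multiplied and combined by the same operations,
    so that no statement has to be made twice.  These are meaningful when the
    sides agree; otherwise the first letter is returned, which keeps the side
    of the result equal to the side of the first argument. *)
Definition lmul x y : letter :=
  match x, y with
  | inl a, inl b => inl (a * b)
  | inr a, inr b => inr (a * b)
  | _, _ => x
  end.

Definition lcomb (c : K) x y : letter :=
  match x, y with
  | inl a, inl b => inl (c *: a + b)
  | inr a, inr b => inr (c *: a + b)
  | _, _ => x
  end.

Lemma side_lmul x y : side (lmul x y) = side x.
Proof. by case: x y => ? []. Qed.

Lemma side_lcomb c x y : side (lcomb c x y) = side x.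
Proof. by case: x y => ? []. Qed.

Lemma side_lunit s : side (lunit s) = s.
Proof. by case: s. Qed.

Lemma lmulA x y z : side x = side y -> side y = side z ->
  lmul x (lmul y z) = lmul (lmul x y) z.
Proof. by case: x y z => a [b|b] [c|c] //= _ _; rewrite mulrA. Qed.

Lemma lmul_lcomb c x y z : side x = side y -> side y = side z ->
  lmul x (lcomb c y z) = lcomb c (lmul x y) (lmul x z).
Proof. by case: x y z => a [b|b] [d|d] //= _ _; rewrite mulrDr scalerAr. Qed.

Lemma lmul1 x : lmul (lunit (side x)) x = x.
Proof. by case: x => a /=; rewrite mul1r. Qed.

Lemma lcomb_lmul c x y z : side x = side y -> side y = side z ->
  lmul (lcomb c x y) z = lcomb c (lmul x z) (lmul y z).
Proof. by case: x y z => a [b|b] [d|d] //= _ _; rewrite mulrDl scalerAl. Qed.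

Lemma letter_form_lcomb (f1 : {scalar A1}) (f2 : {scalar A2}) c x y :
  side x = side y ->
  letter_form f1 f2 (lcomb c x y) =
    c * letter_form f1 f2 x + letter_form f1 f2 y.
Proof. by case: x y => a [b|b] //= _; rewrite linearP. Qed.

Lemma fpletter_lmul x y : side x = side y ->
  fpletter (lmul x y) = fpletter x * fpletter y.
Proof. by case: x y => a [b|b] //= _; rewrite rmorphM. Qed.

Lemma fpletter_lunit s : fpletter (lunit s) = 1.
Proof. by case: s => /=; rewrite rmorph1. Qed.

Definition multilinear (f : seq letter -> K) : Prop :=
  forall u v c x y, side x = side y ->
    f (u ++ lcomb c x y :: v) = c * f (u ++ x :: v) + f (u ++ y :: v).

Lemma multilinear_prod (g1 : {scalar A1}) (g2 : {scalar A2}) :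
  multilinear (fun w => \prod_(x <- w) letter_form g1 g2 x).
Proof.
move=> u v c x y xy; rewrite !big_cat !big_cons letter_form_lcomb //=.
by ring.
Qed.

Variables (psi1 : {scalar A1}) (psi2 : {scalar A2}).
Hypotheses (psi11 : psi1 1 = 1) (psi21 : psi2 1 = 1).
Local Notation psiL := (letter_form psi1 psi2).

Definition lctr x : letter :=
  match x with
  | inl a => inl (a - (psi1 a)%:A)
  | inr b => inr (b - (psi2 b)%:A)
  end.

Lemma side_lctr x : side (lctr x) = side x. Proof. by case: x. Qed.

Lemma lctr_lcomb c x y : side x = side y ->
  lctr (lcomb c x y) = lcomb c (lctr x) (lctr y).
Proof.
by case: x y => a [b|b] //= _;
  rewrite linearP /= scalerBr scalerA scalerDl opprD addrACA.
Qed.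

Lemma psi_lctr x : psiL (lctr x) = 0.
Proof.
by case: x => a /=; rewrite scalarB scalarZ (psi11, psi21) mulr1 subrr.
Qed.

Lemma psi_lunit s : psiL (lunit s) = 1.
Proof. by case: s. Qed.

Lemma lctr_id x : psiL x = 0 -> lctr x = x.
Proof. by case: x => a /= ->; rewrite scale0r subr0. Qed.

Lemma lctr_lunit s : lctr (lunit s) = lcomb (-1) (lunit s) (lunit s).
Proof.
by case: s => /=; rewrite (psi11, psi21) scale1r subrr scaleN1r addNr.
Qed.

Lemma lmul_lctr x y : side x = side y ->
  lmul x y = lcomb (psiL y) x (lmul x (lctr y)).
Proof.
by case: x y => a [b|b] //= _; rewrite mulrBr mulr_algr addrC subrK.
Qed.

Lemma fpletter_lctr x : fpletter (lctr x) = fpletter x - (psiL x)%:A.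
Proof. by case: x => a /=; rewrite linearB linearZ /= rmorph1. Qed.

Definition apart l (w : seq letter) : bool :=
  if w is y :: _ then side l != side y else true.

(** The reduced words, in the form suited to removing the first letter; see
    [goodE]. *)
Fixpoint good (w : seq letter) : bool :=
  if w is x :: w' then [&& apart x w', psiL x == 0 & good w'] else true.

Lemma apart_eq x y w : side x = side y -> apart x w = apart y w.
Proof. by case: w => //= z w ->. Qed.

(** Dual of left multiplication on normal forms.  If the reduced word w does
    not start on the side of x, the normal form of x w is
    (x - psi x) w + psi x w, which explains [push]; if w = y w' does start on
    the side of x, then x w = (x y) w', and w' does not start on that side. *)
Definition push x (f : seq letter -> K) w : K := f (lctr x :: w) + psiL x * f w.

Definition act x f w : K :=
  if apart x w then push x f w
  else if w is y :: w' then push (lmul x y) f w' else 0.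

Lemma act_apart x f w : apart x w -> act x f w = push x f w.
Proof. by rewrite /act => ->. Qed.

Lemma act_same x y f w : side x = side y ->
  act x f (y :: w) = push (lmul x y) f w.
Proof. by rewrite /act /= => ->; rewrite eqxx. Qed.

Lemma push_lcomb c x y f w : multilinear f -> side x = side y ->
  push (lcomb c x y) f w = c * push x f w + push y f w.
Proof.
move=> mf xy; rewrite /push lctr_lcomb // letter_form_lcomb //.
by rewrite (mf [::]) ?side_lctr //=; ring.
Qed.

Lemma act_lcomb c x y f w : multilinear f -> side x = side y ->
  act (lcomb c x y) f w = c * act x f w + act y f w.
Proof.
move=> mf xy; rewrite /act (apart_eq _ (side_lcomb c x y)) (apart_eq _ xy).
case: ifP => yw; first exact: push_lcomb.
case: w yw => // z w /=.
by move=> /negbFE /eqP yz; rewrite lcomb_lmul // push_lcomb // !side_lmul.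
Qed.

Lemma push_multilinear l f : multilinear f -> multilinear (push l f).
Proof.
move=> mf u v c x y xy; rewrite /push mf // (mf (lctr l :: u)) //=.
by ring.
Qed.

Lemma act_multilinear l f : multilinear f -> multilinear (act l f).
Proof.
move=> mf [|z u] v c x y xy.
  have [lx|lx] := eqVneq (side l) (side x).
    rewrite /= !act_same ?side_lcomb // -?xy // lmul_lcomb //.
    by rewrite push_lcomb // !side_lmul.
  rewrite /= !act_apart /= ?side_lcomb // -?xy //.
  exact: (push_multilinear l mf [::]).
have [lz|lz] := eqVneq (side l) (side z).
  by rewrite !cat_cons !act_same //; apply: push_multilinear.
by rewrite !act_apart //; apply: (push_multilinear l mf (z :: u)).
Qed.

(** The relations of the free product hold for [act] only on reduced words: on
    others, acting by the unit letter splits the first letter of the word into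
    its centered part and its psi value.  They are thus stated up to this
    equivalence, which [act] preserves. *)
Definition eq_good (f g : seq letter -> K) : Prop :=
  forall w, good w -> f w = g w.

Lemma good_lctr x w : apart x w -> good w -> good (lctr x :: w).
Proof.
by move=> xw gw /=; rewrite (apart_eq _ (side_lctr x)) xw psi_lctr eqxx.
Qed.

Lemma push_eq_good x f g w : eq_good f g -> apart x w -> good w ->
  push x f w = push x g w.
Proof. by move=> fg xw gw; rewrite /push !fg //; exact: good_lctr. Qed.

Lemma act_eq_good x f g : eq_good f g -> eq_good (act x f) (act x g).
Proof.
move=> fg w gw; have [xw|xw] := boolP (apart x w).
  by rewrite !act_apart //; apply: push_eq_good.
case: w gw xw => //= y w /and3P [yw _ gw]; rewrite negbK => /eqP xy.
rewrite !act_same //; apply: push_eq_good => //.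
by rewrite (apart_eq _ (side_lmul x y)) (apart_eq _ xy).
Qed.

(** The decomposition y = (y - psi y) + psi y has its two terms treated
    differently by [act x]: the first is a letter of the word, to be multiplied
    by x, and the second leaves x in front of w.  Linearity puts them together
    again. *)
Lemma push_act x y f w : multilinear f -> side x = side y -> apart y w ->
  push y (act x f) w = push (lmul x y) f w.
Proof.
move=> mf xy yw; rewrite /(push y) act_same ?side_lctr //.
rewrite act_apart ?(apart_eq _ xy) // (lmul_lctr xy) push_lcomb ?side_lmul //.
by rewrite addrC.
Qed.

Lemma act_lmul x y f : multilinear f -> side x = side y ->
  eq_good (act (lmul x y) f) (act y (act x f)).
Proof.
move=> mf xy w gw; have [yw|yw] := boolP (apart y w).
  rewrite !act_apart ?push_act //.
  by rewrite (apart_eq _ (side_lmul x y)) (apart_eq _ xy).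
case: w gw yw => //= z w /and3P [zw _ gw]; rewrite negbK => /eqP yz.
rewrite !act_same ?side_lmul ?xy // push_act ?side_lmul //.
  by rewrite lmulA.
by rewrite (apart_eq _ (side_lmul y z)) (apart_eq _ yz).
Qed.

Lemma act_lunit s f : multilinear f -> eq_good (act (lunit s) f) f.
Proof.
move=> mf w gw; have [yw|yw] := boolP (apart (lunit s) w).
  rewrite act_apart // /push psi_lunit lctr_lunit (mf [::]) //=.
  by rewrite mulN1r addNr add0r mul1r.
case: w gw yw => //= z w /and3P [zw /eqP pz gw].
rewrite negbK side_lunit => /eqP ->.
by rewrite act_same ?side_lunit // lmul1 /push pz mul0r addr0 lctr_id.
Qed.

(** interp s f w is the value of f on the product of s and w.  As the functions
    are dual to the algebra, the action reverses products. *)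
Fixpoint interp (s : fpterm A1 A2) (f : seq letter -> K) : seq letter -> K :=
  match s with
  | FPl a => act (inl a) f
  | FPr b => act (inr b) f
  | FPzero => fun _ => 0
  | FPone => f
  | FPadd s t => fun w => interp s f w + interp t f w
  | FPmul s t => interp t (interp s f)
  | FPscale c s => fun w => c * interp s f w
  end.

Lemma interp_multilinear s f : multilinear f -> multilinear (interp s f).
Proof.
elim: s f => [a|b|||s IHs t IHt|s IHs t IHt|c s IHs] f mf /=;
  try exact: act_multilinear; try by [].
- by move=> u v c x y _; rewrite mulr0 addr0.
- by move=> u v c x y xy; rewrite IHs // IHt //; ring.
- exact/IHt/IHs.
- by move=> u v d x y xy; rewrite IHs //; ring.
Qed.

Lemma interp_eq_good s f g : eq_good f g -> eq_good (interp s f) (interp s g).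
Proof.
elim: s f g => [a|b|||s IHs t IHt|s IHs t IHt|c s IHs] f g fg //=;
  try exact: act_eq_good.
- by move=> w gw; rewrite (IHs f g) // (IHt f g).
- exact/IHt/IHs.
- by move=> w gw; rewrite (IHs f g).
Qed.

Lemma act_comb x c f g w :
  act x (fun v => c * f v + g v) w = c * act x f w + act x g w.
Proof.
rewrite /act /push; case: ifP => _; first by ring.
by case: w => [|y w]; ring.
Qed.

Lemma interp_comb s c f g w :
  interp s (fun v => c * f v + g v) w = c * interp s f w + interp s g w.
Proof.
suff : interp s (fun v => c * f v + g v) =
    fun w => c * interp s f w + interp s g w by move=> ->.
elim: s f g {w} => [a|b|||s IHs t IHt|s IHs t IHt|d s IHs] f g //=;
  apply/funext => w; try exact: act_comb.
- by rewrite mulr0 addr0.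
- by rewrite IHs IHt /=; ring.
- by rewrite IHs IHt.
- by rewrite IHs /=; ring.
Qed.

Lemma interpD s f g w :
  interp s (fun v => f v + g v) w = interp s f w + interp s g w.
Proof.
have -> : (fun v => f v + g v) = (fun v => 1 * f v + g v).
  by apply/funext => v; rewrite mul1r.
by rewrite interp_comb mul1r.
Qed.

Lemma interpZ s c f w : interp s (fun v => c * f v) w = c * interp s f w.
Proof.
have i0 : interp s (fun=> 0) w = 0.
  have := interp_comb s (-1) (fun=> 0) (fun=> 0) w.
  rewrite [X in interp s X w = _](_ : _ = fun=> 0); last first.
    by apply/funext => v; rewrite mulr0 addr0.
  by rewrite mulN1r addNr.
rewrite -[RHS]addr0 -i0 -interp_comb; congr interp.
by apply/funext => v; rewrite addr0.
Qed.

Lemma interp_fpeq s t : fpeq s t ->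
  forall f, multilinear f -> eq_good (interp s f) (interp t f).
Proof.
elim=> {s t}.
- by [].
- by move=> s t _ IH f mf w gw; rewrite IH.
- by move=> s t u _ IH1 _ IH2 f mf w gw; rewrite IH1 // IH2.
- by move=> s s' t t' _ IH1 _ IH2 f mf w gw /=; rewrite IH1 // IH2.
- move=> s s' t t' _ IH1 _ IH2 f mf w gw /=.
  rewrite IH2 //; first exact: (interp_eq_good _ (IH1 f mf)).
  exact: interp_multilinear.
- by move=> c s s' _ IH f mf w gw /=; rewrite IH.
- by move=> s t u f _ w _ /=; rewrite addrA.
- by move=> s t f _ w _ /=; rewrite addrC.
- by move=> s f _ w _ /=; rewrite add0r.
- by move=> s f _ w _ /=; rewrite mulN1r addNr.
- by [].
- by [].
- by [].
- by move=> s t u f _ w _ /=; rewrite interpD.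
- by [].
- by move=> c d s f _ w _ /=; rewrite mulrA.
- by move=> s f _ w _ /=; rewrite mul1r.
- by move=> c s t f _ w _ /=; rewrite mulrDr.
- by move=> c d s f _ w _ /=; rewrite mulrDl.
- by move=> c s t f _ w _ /=; rewrite interpZ.
- by [].
- move=> c a b f mf w gw /=; rewrite -[inl _]/(lcomb c (inl a) (inl b)).
  by rewrite act_lcomb.
- by move=> a b f mf w gw /=; rewrite -(@act_lmul (inl a) (inl b)).
- by move=> f mf w gw /=; rewrite (@act_lunit true).
- move=> c a b f mf w gw /=; rewrite -[inr _]/(lcomb c (inr a) (inr b)).
  by rewrite act_lcomb.
- by move=> a b f mf w gw /=; rewrite -(@act_lmul (inr a) (inr b)).
- by move=> f mf w gw /=; rewrite (@act_lunit false).
Qed.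

Lemma act_good x f w : good (x :: w) -> act x f w = f (x :: w).
Proof.
case/and3P=> xw /eqP px gw.
by rewrite act_apart // /push px mul0r addr0 lctr_id.
Qed.

Definition word_term (w : seq letter) : fpterm A1 A2 :=
  foldr (fun x => FPmul (match x with inl a => FPl _ a | inr b => FPr _ b end))
    (FPone A1 A2) w.

Lemma fpclass_word_term w : fpclass (word_term w) = wprod fpval w.
Proof.
elim: w => [|x w IH]; first by rewrite wprod0.
rewrite wprod_cons -IH /= -fpmulE.
by case: x.
Qed.

Lemma interp_word_term w f : good w -> interp (word_term w) f [::] = f w.
Proof.
elim: w f => [|x w IH] f // gxw.
have gw : good w by case/and3P: gxw.
rewrite -(act_good f gxw) -(IH _ gw) /=.
by case: x {gxw}.
Qed.

(** The existence part of the normal form theorem for free products: values on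
    reduced words can be prescribed freely, subject to linearity in the
    letters. *)
Lemma word_functional f : multilinear f ->
  exists F : {scalar freeprod A1 A2},
    forall w, good w -> F (wprod fpval w) = f w.
Proof.
move=> mf; pose F (x : freeprod A1 A2) := interp (fprepr x) f [::].
have FE s : F (fpclass s) = interp s f [::].
  by apply: interp_fpeq => //; exact: fprepr_class.
have linF : scalar F.
  move=> c; elim/fpclass_ind => s; elim/fpclass_ind => t.
  by rewrite -[_ + _]/(fpadd (fpscale _ _) _) fpscaleE fpaddE !FE.
pose F' : {scalar freeprod A1 A2} :=
  HB.pack F (GRing.isLinear.Build _ _ _ _ F linF).
exists F' => w gw.
by rewrite -[LHS]/(F _) -fpclass_word_term FE interp_word_term.
Qed.

Lemma goodE (psi : freeprod A1 A2 -> K) w :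
  (forall x, psi (fpletter x) = psiL x) -> good w = reduced side fpval psi w.
Proof.
move=> psiE; rewrite /reduced; elim: w => //= x w ->; rewrite psiE.
case: w => [|y w] //=.
rewrite /neqr; case: (side x != side y) => //=.
by rewrite andbCA.
Qed.

End Letters.
(** * The defining conditions of the product in terms of alphabets *)

Section Alphabet.
Variables (K : fieldType) (A1 A2 : algType K).
Local Notation letter := (A1 + A2)%type.
Local Notation fpval := (@fpletter K A1 A2).

Lemma free_generating : generating fpval.
Proof.
move=> P Pl Pc Pm; elim/fpclass_ind.
have P1 : P 1 by rewrite -(fpletter_lunit A1 A2 true).
have P0 : P 0 by rewrite -(addNr 1) -scaleN1r; exact: Pc.
elim=> [a|b|||s IHs t IHt|s IHs t IHt|c s IHs] //.
- exact: (Pl (inl a)).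
- exact: (Pl (inr b)).
- rewrite -fpaddE -[fpadd _ _]/(fpclass s + _) -[fpclass s]scale1r.
  exact: Pc.
- by rewrite -fpmulE; exact: Pm.
- by rewrite -fpscaleE -[fpscale _ _]addr0; exact: Pc.
Qed.

Lemma free_alphabet : multiplicative_alphabet (@side K A1 A2) fpval.
Proof.
split=> [x y xy|x c].
  by exists (lmul x y); [exact: side_lmul|exact: fpletter_lmul].
exists (lcomb (- c) (lunit A1 A2 (side x)) x).
  by rewrite side_lcomb side_lunit.
by case: x => a /=; rewrite linearP /= rmorph1 scaleNr addrC.
Qed.

Lemma sorted_side (s : seq letter) :
  sorted (@other_side K A1 A2) s = sorted neqr (map (@side K A1 A2) s).
Proof. by rewrite sorted_map; apply: eq_sorted => x y; exact: other_sideE. Qed.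

Lemma cycle_side (s : seq letter) :
  cycle (@other_side K A1 A2) s = cycle neqr (map (@side K A1 A2) s).
Proof.
case: s => //= x s; rewrite -map_rcons path_map; apply: eq_path => y z.
exact: other_sideE.
Qed.

Variables (t1 : triple A1) (t2 : triple A2).

Lemma is_ccfprod_cc_free t :
  is_ccfprod t1 t2 t -> cc_free (@side K A1 A2) fpval t.
Proof.
case=> _ _ _ _ psi0 phiM omM.
split=> [w w0 /andP [srt cen]|w w0 /andP [srt cen]|w].
- by apply: psi0 => //; rewrite /alternating w0 sorted_side.
- by apply: phiM => //; rewrite /alternating w0 sorted_side.
- case/and3P=> w0 cyc cen; apply: omM => //.
  by rewrite /cyc_alternating w0 cycle_side.
Qed.

Lemma cc_free_is_ccfprod t :
  (forall x, [/\ tpsi t (fpval x) = letter_form (tpsi t1) (tpsi t2) x,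
                 tphi t (fpval x) = letter_form (tphi t1) (tphi t2) x &
                 tomega t (fpval x) = letter_form (tomega t1) (tomega t2) x]) ->
  tracial (tomega t) -> cc_free (@side K A1 A2) fpval t -> is_ccfprod t1 t2 t.
Proof.
move=> ext tr [psi0 phiM omM]; split=> //.
- by split=> a; [case: (ext (inl a))|case: (ext (inr a))].
- by split=> a; [case: (ext (inl a))|case: (ext (inr a))].
- by split=> a; [case: (ext (inl a))|case: (ext (inr a))].
- move=> s /andP [s0 srt] cen; apply: psi0 => //.
  by rewrite /reduced -sorted_side srt.
- move=> s /andP [s0 srt] cen; apply: phiM => //.
  by rewrite /reduced -sorted_side srt.
- move=> s /andP [s0 cyc] cen; apply: omM.
  by rewrite /cyc_reduced s0 -cycle_side cyc.
Qed.

End Alphabet.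

(** * Existence of the cyclically conditionally free product *)

Section Existence.
Variables (K : fieldType) (A1 A2 : algType K).
Variables (t1 : triple A1) (t2 : triple A2).
Hypotheses (adm1 : admissible t1) (adm2 : admissible t2).
Hypothesis om12 : tomega t1 1 = tomega t2 1.

Local Notation letter := (A1 + A2)%type.
Implicit Types x y z l : letter.
Local Notation fpval := (@fpletter K A1 A2).
Local Notation psiL := (letter_form (tpsi t1) (tpsi t2)).
Local Notation phiL := (letter_form (tphi t1) (tphi t2)).
Local Notation omL := (letter_form (tomega t1) (tomega t2)).
Local Notation ctr := (lctr (tpsi t1) (tpsi t2)).
Local Notation good := (good (tpsi t1) (tpsi t2)).
Local Notation phiW w := (\prod_(x <- w) phiL x).

Let psi11 : tpsi t1 1 = 1. Proof. by case: adm1. Qed.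
Let psi21 : tpsi t2 1 = 1. Proof. by case: adm2. Qed.
Let phi11 : tphi t1 1 = 1. Proof. by case: adm1. Qed.
Let phi21 : tphi t2 1 = 1. Proof. by case: adm2. Qed.
Let wordF := word_functional psi11 psi21.

Lemma letter_value (F : {scalar freeprod A1 A2}) f x :
  (forall w, good w -> F (wprod fpval w) = f w) ->
  F (fpval x) = f [:: ctr x] + psiL x * f [::].
Proof.
move=> FE; rewrite -!FE ?good_lctr //.
by rewrite wprod_cons wprod0 mulr1 fpletter_lctr scalarB scalarZ subrK.
Qed.

Lemma exists_psi : exists F : {scalar freeprod A1 A2},
  forall w, good w -> F (wprod fpval w) = (size w == 0)%:R.
Proof.
apply: wordF => u v c x y _.
by rewrite !size_cat /= !addnS mulr0 addr0.
Qed.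

Lemma psi_values (F : {scalar freeprod A1 A2}) :
  (forall w, good w -> F (wprod fpval w) = (size w == 0)%:R) ->
  F 1 = 1 /\ forall x, F (fpval x) = psiL x.
Proof.
move=> FE; split=> [|x]; first by rewrite -(wprod0 fpval) FE.
by rewrite (letter_value x FE) /= add0r mulr1.
Qed.

Lemma omL_lmulC x y : side x = side y -> omL (lmul x y) = omL (lmul y x).
Proof.
case: adm1 => _ _ tr1; case: adm2 => _ _ tr2.
by case: x y => a [b|b] //= _; rewrite ?tr1 ?tr2.
Qed.

Lemma form_lmul_lctr (g1 : {scalar A1}) (g2 : {scalar A2}) x y :
  side x = side y -> letter_form g1 g2 (lmul x (ctr y)) =
  letter_form g1 g2 (lmul x y) - psiL y * letter_form g1 g2 x.
Proof.
by case: x y => a [b|b] //= _; rewrite mulrBr mulr_algr scalarB scalarZ.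
Qed.

Lemma form_lctr_lmul (g1 : {scalar A1}) (g2 : {scalar A2}) x y :
  side x = side y -> letter_form g1 g2 (lmul (ctr x) y) =
  letter_form g1 g2 (lmul x y) - psiL x * letter_form g1 g2 y.
Proof.
by case: x y => a [b|b] //= _; rewrite mulrBl mulr_algl scalarB scalarZ.
Qed.

Lemma phi_lctr x : phiL (ctr x) = phiL x - psiL x.
Proof. by case: x => a /=; rewrite scalarB scalarZ (phi11, phi21) mulr1. Qed.

Lemma om_lctr x : omL (ctr x) = omL x - psiL x * tomega t1 1.
Proof. by case: x => a /=; rewrite scalarB scalarZ -?om12. Qed.

(** The value which traciality forces on x m y, given the value g on m: rotating
    y to the front, y x is a letter when x and y lie on the same side, and
    splits into its centered part, which makes the word cyclically alternating,
    and psi (y x). *)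
Definition close_ends x y (m : seq letter) (g : K) : K :=
  if side x == side y then
    (phiL (lmul y x) - psiL (lmul y x)) * phiW m + psiL (lmul y x) * g
  else phiL x * phiL y * phiW m.

(** The fuel k counts the pairs of ends still to be removed.  The unit of the
    algebra, the empty word, gets the common value of the omegas at 1. *)
Fixpoint omega_rec k (w : seq letter) : K :=
  match w with
  | [::] => tomega t1 1
  | x :: w' =>
    match rev w', k with
    | [::], _ => omL x
    | y :: m, k'.+1 => close_ends x y (rev m) (omega_rec k' (rev m))
    | _, 0 => 0
    end
  end.

Definition omega_word w := omega_rec (size w)./2 w.

Lemma omega_word_ends x m y :
  omega_word (x :: rcons m y) = close_ends x y m (omega_word m).
Proof.
rewrite /omega_word [size _]/= size_rcons -[_./2]/(size m)./2.+1.
by rewrite [LHS]/= rev_rcons revK.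
Qed.

Lemma omega_word1 x : omega_word [:: x] = omL x.
Proof. by []. Qed.

Lemma close_ends_lcomb_l c x x' y m g : side x = side x' ->
  close_ends (lcomb c x x') y m g =
    c * close_ends x y m g + close_ends x' y m g.
Proof.
move=> xx'; rewrite /close_ends side_lcomb -xx'.
have [xy|xy] := eqVneq (side x) (side y).
  by rewrite lmul_lcomb // !letter_form_lcomb ?side_lmul //; ring.
by rewrite letter_form_lcomb //; ring.
Qed.

Lemma close_ends_lcomb_r c x y y' m g : side y = side y' ->
  close_ends x (lcomb c y y') m g =
    c * close_ends x y m g + close_ends x y' m g.
Proof.
move=> yy'; rewrite /close_ends side_lcomb -yy'.
have [xy|xy] := eqVneq (side x) (side y).
  by rewrite lcomb_lmul -?xy -?yy' // !letter_form_lcomb ?side_lmul //; ring.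
by rewrite letter_form_lcomb //; ring.
Qed.

Lemma omega_word_multilinear : multilinear omega_word.
Proof.
move=> u v c x y xy; have [n] := ubnP (size u); elim: n u v => // n IH u v.
rewrite ltnS; case: u => [|l u] sz; case: (lastP v) => [|{}v r].
- by rewrite !omega_word1 letter_form_lcomb.
- by rewrite !omega_word_ends close_ends_lcomb_l.
- by rewrite !cats1 !rcons_cons !omega_word_ends close_ends_lcomb_r.
rewrite -!rcons_cons -!rcons_cat !rcons_cons !omega_word_ends /close_ends IH //.
rewrite (multilinear_prod _ _ _ _ _ xy).
by case: ifP => _; ring.
Qed.

Lemma omega_word_cyc x p : side x != side (last x p) ->
  omega_word (x :: p) = phiW (x :: p).
Proof.
case/lastP: p => [|m y]; first by rewrite eqxx.
rewrite last_rcons omega_word_ends /close_ends => /negPf ->.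
by rewrite big_cons -cats1 big_cat big_seq1 /=; ring.
Qed.

Section Tracial.
Variable F : {scalar freeprod A1 A2}.
Hypothesis FE : forall w, good w -> F (wprod fpval w) = omega_word w.

Lemma omega_mul_head x w : apart x w -> good w ->
  F (fpval x * wprod fpval w) = omega_word (ctr x :: w) + psiL x * omega_word w.
Proof.
move=> xw gw; rewrite -!FE //; last exact: good_lctr.
by rewrite wprod_cons fpletter_lctr mulrBl mulr_algl scalarB scalarZ subrK.
Qed.

Lemma good_rcons x w y :
  good (rcons (x :: w) y) =
    [&& good (x :: w), psiL y == 0 & side (last x w) != side y].
Proof.
elim: w x => [|z w IH] x /=; first by rewrite !andbT andbC andbA.
by have := IH z => /= ->; rewrite -!andbA.
Qed.

Lemma omega_mul_last x w y : good (x :: w) -> side (last x w) != side y ->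
  F (wprod fpval (x :: w) * fpval y) =
  omega_word (rcons (x :: w) (ctr y)) + psiL y * omega_word (x :: w).
Proof.
move=> gw xw; rewrite -!FE //; last first.
  by rewrite good_rcons gw psi_lctr // eqxx side_lctr.
rewrite -(cats1 (x :: w) (ctr y)) wprod_cat (wprod_cons _ _ [::]) wprod0 mulr1.
by rewrite fpletter_lctr mulrBr mulr_algr scalarB scalarZ subrK.
Qed.

(** If l differs in side from both ends, l w and w l are reduced and cyclically
    alternating.  If l meets just one end, one of the two words merges l with
    that end, and the other is, by definition of [omega_word], evaluated by
    cyclically performing the same merging.  If l meets both ends x and y, both
    sides equal the value for the merged letter y l x: the corrections coming
    from centering l x on one side and y l on the other cancel. *)
Lemma omega_letter_comm l w : psiL l = 0 -> good w ->
  F (fpval l * wprod fpval w) = F (wprod fpval w * fpval l).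
Proof.
move=> pl; case: w => [|x w]; first by rewrite wprod0 mulr1 mul1r.
have cl := lctr_id pl.
case: (lastP w) => [|m y] gw.
  rewrite wprod_cons wprod0 mulr1.
  have [lx|lx] := eqVneq (side l) (side x).
    rewrite -!fpletter_lmul //.
    have Fl z : F (fpval z) = omL z.
      rewrite -[fpval z]mulr1 -(wprod0 fpval) omega_mul_head //.
      by rewrite omega_word1 om_lctr /omega_word /= subrK.
    by rewrite !Fl omL_lmulC.
  have -> : fpval l * fpval x = fpval l * wprod fpval [:: x].
    by rewrite wprod_cons wprod0 mulr1.
  have -> : fpval x * fpval l = wprod fpval [:: x] * fpval l.
    by rewrite wprod_cons wprod0 mulr1.
  rewrite omega_mul_head // omega_mul_last //; last by rewrite eq_sym.
  rewrite pl !mul0r !addr0 cl /= !omega_word_cyc //=; last by rewrite eq_sym.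
  by rewrite !big_cons !big_nil; ring.
have /and3P [xm /eqP px gm] := gw.
have : good (rcons (x :: m) y) by [].
rewrite good_rcons => /and3P [gxm /eqP py my].
have EL : side l = side x ->
    F (fpval l * wprod fpval (x :: rcons m y)) =
    omega_word (ctr (lmul l x) :: rcons m y)
    + psiL (lmul l x) * omega_word (rcons m y).
  move=> lx; rewrite wprod_cons mulrA -fpletter_lmul // omega_mul_head //.
  by rewrite (apart_eq _ (side_lmul l x)) (apart_eq _ lx).
have ER : side l = side y ->
    F (wprod fpval (x :: rcons m y) * fpval l) =
    omega_word (x :: rcons m (ctr (lmul y l)))
    + psiL (lmul y l) * omega_word (x :: m).
  move=> ly; rewrite -rcons_cons -cats1 wprod_cat -mulrA.
  by rewrite (wprod_cons _ y) wprod0 mulr1 -fpletter_lmul // omega_mul_last //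
    side_lmul.
have [lx|lx] := eqVneq (side l) (side x);
  have [ly|ly] := eqVneq (side l) (side y).
- have xy : side x = side y by rewrite -lx.
  have -> : F (fpval l * wprod fpval (x :: rcons m y)) =
      (phiL (lmul y (lmul l x)) - psiL (lmul y (lmul l x))) * phiW m
      + psiL (lmul y (lmul l x)) * omega_word m.
    rewrite EL // omega_word_ends /close_ends side_lctr side_lmul ly eqxx.
    rewrite !form_lmul_lctr ?side_lmul // py mulr0 subr0.
    have -> : omega_word (rcons m y) = phiW (rcons m y).
      case: (m) xm my => [|z m'] /=; first by rewrite xy eqxx.
      by move=> xz _; rewrite omega_word_cyc // last_rcons -xy eq_sym.
    by rewrite -cats1 big_cat big_seq1 /=; ring.
  rewrite ER // omega_word_ends /close_ends side_lctr side_lmul xy eqxx.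
  rewrite !form_lctr_lmul ?side_lmul // px mulr0 subr0 lmulA //.
  by rewrite omega_word_cyc ?big_cons /= 1?eq_sym ?xy //; ring.
- rewrite EL // omega_mul_last ?last_rcons 1?eq_sym // pl mul0r addr0 cl.
  rewrite omega_word_ends /close_ends side_lctr side_lmul (negPf ly).
  rewrite -rcons_cons rcons_cons omega_word_ends /close_ends -lx eqxx phi_lctr.
  by rewrite -cats1 big_cat big_seq1 /=; ring.
- rewrite ER // omega_mul_head // pl mul0r addr0 cl -rcons_cons omega_word_ends.
  rewrite omega_word_ends /close_ends side_lctr side_lmul -ly eqxx.
  rewrite (eq_sym (side x)) (negPf lx) phi_lctr.
  by rewrite big_cons; ring.
- rewrite omega_mul_head // omega_mul_last ?last_rcons 1?eq_sym //.
  rewrite pl !mul0r !addr0 cl /= !omega_word_cyc /= ?last_rcons //; last first.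
    by rewrite eq_sym.
  by rewrite -!cats1 !(big_cons, big_cat, big_nil) /=; ring.
Qed.

(** Elements commuting with everything under F form a subalgebra, so letters
    suffice; a letter may be centered since scalars are central, and the other
    factor may be taken reduced. *)
Lemma omega_tracial : tracial F.
Proof.
suff H : forall b a, F (a * b) = F (b * a) by move=> a b; exact: H.
apply: free_generating; last first.
- by move=> a b Pa Pb x; rewrite mulrA Pb mulrA Pa mulrA.
- move=> c a b Pa Pb x.
  by rewrite mulrDr mulrDl -scalerAl -scalerAr !linearP /= Pa Pb.
move=> x.
suff H l a : psiL l = 0 -> F (fpval l * a) - F (a * fpval l) = 0.
  move=> a; have /eqP := H (ctr x) a (psi_lctr psi11 psi21 x).
  rewrite fpletter_lctr mulrBl mulrBr mulr_algl mulr_algr !scalarB !scalarZ.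
  by rewrite subr_eq0 => /eqP /addIr.
move=> pl; move: a.
have lin : scalar (fun a => F (fpval l * a) - F (a * fpval l)).
  by move=> c a b; rewrite mulrDr mulrDl -scalerAl -scalerAr !linearP /=; ring.
apply: (vanish_of_words (@free_generating _ _ _) lin).
have [Fpsi FpsiE] := exists_psi.
have [Fpsi1 Fpsi_letter] := psi_values FpsiE.
apply: (vanish_of_reduced (@free_alphabet _ _ _) Fpsi1 lin) => w rw _.
rewrite -(goodE _ Fpsi_letter) in rw.
by rewrite omega_letter_comm // subrr.
Qed.

End Tracial.

Lemma ccfprod_exists : exists t, is_ccfprod t1 t2 t.
Proof.
have [Fpsi FpsiE] := exists_psi; have [Fpsi1 Fpsi_letter] := psi_values FpsiE.
have [Fphi FphiE] := wordF (multilinear_prod (tphi t1) (tphi t2)).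
have [Fom FomE] := wordF omega_word_multilinear.
have Fphi_letter x : Fphi (fpval x) = phiL x.
  by rewrite (letter_value x FphiE) big_seq1 big_nil mulr1 phi_lctr subrK.
have phiWE w : \prod_(x <- w) Fphi (fpval x) = phiW w.
  by apply: eq_bigr => x _; exact: Fphi_letter.
exists (Triple Fpsi Fphi Fom); apply: cc_free_is_ccfprod => /=.
- move=> x; split=> //.
  by rewrite (letter_value x FomE) omega_word1 om_lctr subrK.
- exact: omega_tracial.
split=> /= w.
- by move=> w0; rewrite -(goodE _ Fpsi_letter) => /FpsiE ->; case: w w0.
- by move=> _; rewrite -(goodE _ Fpsi_letter) phiWE => /FphiE.
- move=> cw; have := cyc_reduced_reduced cw.
  rewrite -(goodE _ Fpsi_letter) phiWE => /FomE ->.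
  case: w cw => // x p /and3P [_ /=].
  rewrite rcons_path last_map => /andP [_ lx] _.
  by rewrite omega_word_cyc // eq_sym.
Qed.

End Existence.

(** * Moving words between algebras *)

(** Words over N with values in C are sent, by g on letters and by k on values,
    to words over L with values in B.  With g onto a coarse factor of L this
    supplies the inner product to the grouping lemma; with g the identity it
    moves the rule along an isomorphism such as the associator. *)
Section Transport.
Variables (K : fieldType) (C B : algType K) (k : {lrmorphism C -> B}).
Variables (N L : Type) (I' I : eqType) (g : N -> L).
Variables (tagN : N -> I') (valN : N -> C) (tag : L -> I) (val : L -> B).
Hypothesis tag_g : forall x y, (tag (g x) == tag (g y)) = (tagN x == tagN y).
Hypothesis val_g : forall x, val (g x) = k (valN x).
Variables (tN : triple C) (t : triple B).
Hypothesis psi_k : forall c, tpsi t (k c) = tpsi tN c.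
Hypothesis phi_k : forall c, tphi t (k c) = tphi tN c.
Hypothesis omega_k : forall c, tomega t (k c) = tomega tN c.

Lemma wprod_map v : wprod val (map g v) = k (wprod valN v).
Proof. by rewrite /wprod big_map rmorph_prod; apply: eq_bigr => x _. Qed.

Lemma phi_prod_map v :
  \prod_(x <- map g v) tphi t (val x) = \prod_(x <- v) tphi tN (valN x).
Proof. by rewrite big_map; apply: eq_bigr => x _; rewrite val_g phi_k. Qed.

Lemma centered_map v :
  all (fun x => tpsi t (val x) == 0) (map g v) =
  all (fun x => tpsi tN (valN x) == 0) v.
Proof. by rewrite all_map; apply: eq_all => x /=; rewrite val_g psi_k. Qed.

Lemma reduced_map v :
  reduced tag val (tpsi t) (map g v) = reduced tagN valN (tpsi tN) v.
Proof.
rewrite /reduced centered_map -map_comp !sorted_map; congr (_ && _).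
by apply: eq_sorted => x y; rewrite /= /neqr tag_g.
Qed.

Lemma cyc_reduced_map v :
  cyc_reduced tag val (tpsi t) (map g v) = cyc_reduced tagN valN (tpsi tN) v.
Proof.
rewrite /cyc_reduced centered_map size_map -map_comp; congr [&& _, _ & _].
case: v => //= x v; rewrite -!map_rcons !path_map.
by apply: eq_path => y z; rewrite /= /neqr tag_g.
Qed.

Lemma cc_free_comp : cc_free tag val t -> cc_free tagN valN tN.
Proof.
case=> psi0 phiM omM; split=> [w w0 rw|w w0 rw|w cw].
- by rewrite -psi_k -wprod_map psi0 ?size_map ?reduced_map.
- by rewrite -phi_k -wprod_map phiM ?size_map ?reduced_map ?phi_prod_map.
- by rewrite -omega_k -wprod_map omM ?cyc_reduced_map ?phi_prod_map.
Qed.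

Variables (J : eqType) (f : L -> J) (j : J).
Hypothesis fibre_g : forall x, f x = j -> exists y, x = g y.
Hypothesis freeN : cc_free tagN valN tN.

Lemma fibre_word u : all (fun y => f y == j) u -> exists v, u = map g v.
Proof.
elim: u => [|x u IH] /=; first by exists [::].
by case/andP => /eqP /fibre_g [y ->] /IH [v ->]; exists (y :: v).
Qed.

Lemma fibre_run x u : f x = j -> all (fun y => f y == f x) u ->
  reduced tag val (tpsi t) (x :: u) ->
  exists c, [/\ wprod val (x :: u) = k c, tpsi t (k c) = 0 &
                tphi t (k c) = \prod_(y <- x :: u) tphi t (val y)].
Proof.
move=> fx fu; have [|v ev] := @fibre_word (x :: u).
  by rewrite /= fx eqxx -fx.
have v0 : (0 < size v)%N by rewrite -(size_map g) -ev.
rewrite ev reduced_map => rv; exists (wprod valN v).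
rewrite wprod_map psi_k phi_k phi_prod_map.
by split; [|exact: (ccfree_psi freeN)|exact: (ccfree_phi freeN)].
Qed.

Lemma fibre_cyc x u : f x = j -> all (fun y => f y == f x) u ->
  cyc_reduced tag val (tpsi t) (x :: u) ->
  tomega t (wprod val (x :: u)) = \prod_(y <- x :: u) tphi t (val y).
Proof.
move=> fx fu; have [|v ->] := @fibre_word (x :: u).
  by rewrite /= fx eqxx -fx.
rewrite cyc_reduced_map => cv.
by rewrite wprod_map omega_k phi_prod_map; apply: (ccfree_omega freeN).
Qed.

End Transport.

(** A coarse factor which is not itself a product has only one tag, so that its
    runs are single letters. *)
Section OneFactor.
Variables (K : fieldType) (B : algType K) (I : eqType) (L : Type).
Variables (tag : L -> I) (val : L -> B).

Lemma reduced_one_tag psi x u : reduced tag val psi (x :: u) ->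
  all (fun y => tag y == tag x) u -> u = [::].
Proof.
case: u => // y u /andP [/= /andP [xy _] _] /andP [/eqP e _].
by rewrite e /neqr eqxx in xy.
Qed.

Lemma cyc_reduced_one_tag psi x u : cyc_reduced tag val psi (x :: u) ->
  all (fun y => tag y == tag x) u -> False.
Proof.
move=> cu au; have u0 := reduced_one_tag (cyc_reduced_reduced cu) au.
by move: cu; rewrite u0 /cyc_reduced /= /neqr eqxx.
Qed.

End OneFactor.

Lemma triple_eq (K : fieldType) (A : algType K) (t t' : triple A) :
  tpsi t =1 tpsi t' -> tphi t =1 tphi t' -> tomega t =1 tomega t' -> t = t'.
Proof.
have scalar_eq (f f' : {scalar A}) : f =1 f' -> f = f'.
  case: f f' => [f cf] [f' cf'] /funext /= ff'; rewrite ff' in cf *.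
  case: cf cf' => [[n] [s]] [[n'] [s']].
  by rewrite (Prop_irrelevance n n') (Prop_irrelevance s s').
case: t t' => [a b c] [a' b' c'] /=.
by move=> /scalar_eq -> /scalar_eq -> /scalar_eq ->.
Qed.

Section Ccfprod.
Variables (K : fieldType) (A1 A2 : algType K) (t1 : triple A1) (t2 : triple A2).
Hypotheses (adm1 : admissible t1) (adm2 : admissible t2).
Hypothesis om12 : tomega t1 1 = tomega t2 1.

Lemma ccfprodP : is_ccfprod t1 t2 (ccfprod t1 t2).
Proof. by apply: xgetPex; exact: ccfprod_exists. Qed.

Lemma ccfprod_omega1 : tomega (ccfprod t1 t2) 1 = tomega t1 1.
Proof. by rewrite -(ccf_omega_ext ccfprodP).1 rmorph1. Qed.

Lemma ccfprod_admissible : admissible (ccfprod t1 t2).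
Proof.
have [epsi ephi _ tr _ _ _] := ccfprodP; case: adm1 => psi1 phi1 _.
by split; rewrite // -(rmorph1 fpinl) (epsi.1, ephi.1).
Qed.

End Ccfprod.

(** * Three factors *)

Section Threefold.
Variables (K : fieldType) (A1 A2 A3 : algType K).
Local Notation letter3 := ((A1 + A2) + A3)%type.
Local Notation A12 := (freeprod A1 A2).
Local Notation A23 := (freeprod A2 A3).
Local Notation B := (freeprod A12 A3).
Implicit Types x : letter3.

Definition tag3 x : option bool := if x is inl y then Some (side y) else None.

Definition val3 x : B :=
  match x with inl y => fpinl (fpletter y) | inr c => fpinr c end.

Definition val3' x : freeprod A1 A23 :=
  match x with
  | inl (inl a) => fpinl a
  | inl (inr b) => fpinr (fpinl b)
  | inr c => fpinr (fpinr c)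
  end.

Lemma val3'E x : fp_assoc A1 A2 A3 (val3 x) = val3' x.
Proof.
case: x => [[a|b]|c] /=.
- by rewrite freeprod_lift_inl /= freeprod_lift_inl.
- by rewrite freeprod_lift_inl /= freeprod_lift_inr.
- by rewrite freeprod_lift_inr.
Qed.

Lemma generating3 : generating val3.
Proof.
move=> P Pl Pc Pm; apply: free_generating => // -[e|c]; last first.
  exact: (Pl (inr c)).
move: e; apply: (@free_generating _ _ _ (fun e => P (fpinl e)))
  => [l|c a b Pa Pb|a b Pa Pb].
- exact: (Pl (inl l)).
- by rewrite linearP; exact: Pc.
- by rewrite rmorphM; exact: Pm.
Qed.

Lemma alphabet3 : multiplicative_alphabet tag3 val3.
Proof.
have [merge2 shift2] := @free_alphabet _ A1 A2.
split=> [[x|a] [y|b] //|[x|a] c].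
- case=> /merge2 [z tz vz]; exists (inl z); rewrite /= ?tz //.
  by rewrite vz rmorphM.
- by exists (inr (a * b)); rewrite //= rmorphM.
- have [z tz vz] := shift2 x c; exists (inl z); rewrite /= ?tz //.
  by rewrite vz linearB linearZ /= rmorph1.
- by exists (inr (a - c%:A)); rewrite //= linearB linearZ /= rmorph1.
Qed.

Variables (t1 : triple A1) (t2 : triple A2) (t3 : triple A3).

(** Runs in A1 * A2 obey the rule of the inner product, and runs in A3 are
    single letters. *)
Lemma cc_free_bracket_left t12 t :
  is_ccfprod t1 t2 t12 -> is_ccfprod t12 t3 t ->
  cc_free tag3 val3 t.
Proof.
move=> cc12 cc; have free12 := is_ccfprod_cc_free cc12.
have [[psi12 _] [phi12 _] [om12 _] tr _ _ _] := cc.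
pose f x : bool := if x is inl _ then true else false.
have tag_g (y z : A1 + A2) :
  (tag3 (inl y) == tag3 (inl z)) = (side y == side z) by [].
have fibre_g x : f x = true -> exists y, x = inl y.
  by case: x => // y _; exists y.
have one x u : f x = false -> all (fun y => f y == f x) u ->
    all (fun y => tag3 y == tag3 x) u.
  by case: x => // c _; apply: sub_all => -[].
apply: (cc_free_group (f := f) _ _ tr (is_ccfprod_cc_free cc)) => x u rxu fu.
  case: x rxu fu => [y|c] rxu fu.
    have [a [-> pa phia]] := fibre_run tag_g (fun=> erefl) psi12 phi12 fibre_g
      free12 (erefl : f (inl y) = true) fu rxu.
    by exists (inl a).
  have u0 := reduced_one_tag rxu (one (inr c) u erefl fu); subst u.
  exists (inr c); rewrite big_seq1 wprod_cons wprod0 mulr1; split=> //=.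
  by case/andP: rxu => _ /andP [/eqP].
case: x rxu fu => [y|c] rxu fu; last first.
  by case: (cyc_reduced_one_tag rxu (one (inr c) u erefl fu)).
exact: (fibre_cyc tag_g (fun=> erefl) psi12 phi12 om12 fibre_g free12
  (erefl : f (inl y) = true) fu rxu).
Qed.

(** Here the runs in A1 are single letters, and those in A2 * A3 obey the rule
    of the inner product. *)
Lemma cc_free_bracket_right t23 t :
  is_ccfprod t2 t3 t23 -> is_ccfprod t1 t23 t ->
  cc_free tag3 val3' t.
Proof.
move=> cc23 cc; have free23 := is_ccfprod_cc_free cc23.
have [[_ psi23] [_ phi23] [_ om23] tr _ _ _] := cc.
pose f x : bool := if x is inl (inl _) then true else false.
pose g (y : A2 + A3) : letter3 :=
  match y with inl b => inl (inr b) | inr c => inr c end.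
have tag_g y z : (tag3 (g y) == tag3 (g z)) = (side y == side z).
  by case: y z => ? [].
have val_g y : val3' (g y) = fpinr (fpletter y) by case: y.
have fibre_g x : f x = false -> exists y, x = g y.
  by case: x => [[|b]|c] // _; [exists (inl b)|exists (inr c)].
have one a u : all (fun y => f y == true) u ->
    all (fun y => tag3 y == tag3 (inl (inl a))) u.
  by apply: sub_all => -[[]|].
apply: (cc_free_group (f := f) _ _ tr (is_ccfprod_cc_free cc)) => x u rxu fu.
  have [fx|fx] := boolP (f x); last first.
    have [a [-> pa phia]] :=
      fibre_run tag_g val_g psi23 phi23 fibre_g free23 (negbTE fx) fu rxu.
    by exists (inr a); split=> //; exact/esym/negbTE.
  case: x fx rxu fu => [[a|//]|//] _ rxu fu.
  have u0 := reduced_one_tag rxu (one a u fu); subst u.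
  exists (inl a); rewrite big_seq1 wprod_cons wprod0 mulr1; split=> //=.
  by case/andP: rxu => _ /andP [/eqP].
have [fx|fx] := boolP (f x).
  case: x fx rxu fu => [[a|//]|//] _ rxu fu.
  by case: (cyc_reduced_one_tag rxu (one a u fu)).
exact: (fibre_cyc tag_g val_g psi23 phi23 om23 fibre_g free23
  (negbTE fx) fu rxu).
Qed.

End Threefold.

Theorem proposition3p1p5 (R : realType) (A1 A2 A3 : algType R[i])
    (t1 : triple A1) (t2 : triple A2) (t3 : triple A3)
    (adm1 : admissible t1) (adm2 : admissible t2) (adm3 : admissible t3)
    (omega12 : tomega t1 1 = tomega t2 1)
    (omega23 : tomega t2 1 = tomega t3 1) :
  ccfprod (ccfprod t1 t2) t3 =
  triple_comp (ccfprod t1 (ccfprod t2 t3)) (fp_assoc A1 A2 A3).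
Proof.
have cc12 := ccfprodP adm1 adm2 omega12.
have cc23 := ccfprodP adm2 adm3 omega23.
have adm12 := ccfprod_admissible adm1 adm2 omega12.
have adm23 := ccfprod_admissible adm2 adm3 omega23.
have omega12_3 : tomega (ccfprod t1 t2) 1 = tomega t3 1.
  by rewrite ccfprod_omega1 // omega12.
have omega1_23 : tomega t1 1 = tomega (ccfprod t2 t3) 1.
  by rewrite ccfprod_omega1.
have ccl := ccfprodP adm12 adm3 omega12_3.
have ccr := ccfprodP adm1 adm23 omega1_23.
set t := ccfprod (ccfprod t1 t2) t3 in ccl *.
set t' := ccfprod t1 (ccfprod t2 t3) in ccr *.
have freel : cc_free (@tag3 _ A1 A2 A3) (@val3 _ A1 A2 A3) t.
  exact: cc_free_bracket_left cc12 ccl.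
have freer : cc_free (@tag3 _ A1 A2 A3) (@val3 _ A1 A2 A3)
    (triple_comp t' (fp_assoc A1 A2 A3)).
  apply: (@cc_free_comp _ _ _ (fp_assoc A1 A2 A3) _ _ _ _ id
    _ _ _ _ (fun _ _ => erefl) _ _ t') (cc_free_bracket_right cc23 ccr) => //.
  by move=> x; rewrite val3'E.
have [[pl3 pr3] [hl3 hr3] [ol3 or3] trl _ _ _] := ccl.
have [[pl2 pr2] [hl2 hr2] [ol2 or2] trr _ _ _] := ccr.
have [[pl12 pr12] [hl12 hr12] [ol12 or12] _ _ _ _] := cc12.
have [[pl23 pr23] [hl23 hr23] [ol23 or23] _ _ _ _] := cc23.
have [||||epsi ephi eom] := cc_free_unique (@alphabet3 _ A1 A2 A3)
  (@generating3 _ A1 A2 A3) _ _ freel freer trl.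
- by exists (inl (inl 1)); rewrite /= !rmorph1.
- by case: (ccfprod_admissible adm12 adm3 omega12_3).
- by move=> a b; rewrite /= rmorphM trr rmorphM.
- move=> x; rewrite [tpsi (triple_comp _ _) _]/= [tphi (triple_comp _ _) _]/=.
  rewrite [tomega (triple_comp _ _) _]/= val3'E.
  by case: x => [[a|b]|c] /=; split;
    rewrite !(pl3, pr3, hl3, hr3, ol3, or3, pl2, pr2, hl2, hr2, ol2, or2,
    pl12, pr12, hl12, hr12, ol12, or12, pl23, pr23, hl23, hr23, ol23, or23).
exact: triple_eq.
Qed.
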